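(* Let $G=G_1*G_2$ be the join of $G_1$ and $G_2$, where $G_1$ and $G_2$ are disconnected graphs on $[n_1]$ and $[n_2]$ respectively. Assume that $n_2\geq n_1$. Then $$\operatorname{depth}_S(S/J_G)=\min\{\operatorname{depth}_{S_1}(S_1/J_{G_1}),\ \operatorname{depth}_{S_2}(S_2/J_{G_2}),\ n_1+2\}.$$
   Context: $\mathbb{K}$ is an arbitrary field and all graphs are finite and simple; $[n]=\{1,\dots,n\}$. For a graph $\Gamma$, its binomial edge ideal $J_\Gamma$ is the ideal of the polynomial ring $\mathbb{K}[x_u,y_u : u\in V(\Gamma)]$ generated by the binomials $x_uy_w-x_wy_u$ with $\{u,w\}\in E(\Gamma)$. The join $G_1*G_2$ has vertex set $[n_1]\sqcup[n_2]$ (disjoint union) and edge set $E(G_1)\cup E(G_2)\cup\{\{i,j\} : i\in[n_1], j\in[n_2]\}$. Put $S_i=\mathbb{K}[x_j,y_j : j\in[n_i]]$ for $i=1,2$ and $S=\mathbb{K}[x_j,y_j : j\in[n_1]\sqcup[n_2]]$. Depth is with respect to the graded maximal ideal. *)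

(* Defs.v *)
From HB Require Import structures.
From mathcomp Require Import all_boot all_order all_algebra.
From mathcomp Require Import mpoly.
From Stdlib Require Import ClassicalEpsilon.

Set Implicit Arguments.
Unset Strict Implicit.
Unset Printing Implicit Defensive.

Import GRing.Theory.
Local Open Scope ring_scope.

Section Depth.
Variable R : comNzRingType.
Implicit Types (A I m : R -> Prop) (s : seq R).

Definition ideal_gen A (f : R) : Prop :=
  exists (k : nat) (c g : 'I_k -> R),
    (forall i, A (g i)) /\ f = \sum_(i < k) c i * g i.

Definition ideal_adjoin I s : R -> Prop :=
  ideal_gen (fun f => I f \/ f \in s).

(* Regularity of s on the module R/I, read back in R: multiplication by s_i is
   injective on R/(I + (s_0, ..., s_{i-1})), and R/(I + (s)) is nonzero. *)
Definition regular_seq I s : Prop :=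
  (forall i, (i < size s)%N -> forall g : R,
     ideal_adjoin I (take i s) (s`_i * g) -> ideal_adjoin I (take i s) g)
  /\ ~ ideal_adjoin I s 1.

Definition regular_seq_in m I s : Prop :=
  (forall f, f \in s -> m f) /\ regular_seq I s.

Definition is_depth m I (d : nat) : Prop :=
  (exists2 s, regular_seq_in m I s & size s = d)
  /\ (forall s, regular_seq_in m I s -> (size s <= d)%N).

(* The depth of R/I with respect to m.  The maximum exists whenever R is
   Noetherian and m + I is a proper ideal, and it is then unique; in
   particular it exists for an ideal I generated by polynomials without
   constant term and m the graded maximal ideal. *)
Definition depth m I : nat := epsilon (inhabits 0%N) (is_depth m I).

End Depth.

Definition graded_max (K : fieldType) (n : nat) : {mpoly K[n]} -> Prop :=
  ideal_gen (fun f => exists i : 'I_n, f = 'X_i).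

(* mpoly.v shadows the name symmetric. *)
Definition simple_graph (n : nat) (e : rel 'I_n) : Prop :=
  ssrbool.symmetric e /\ irreflexive e.

(* The graph without vertices is not disconnected in this sense. *)
Definition disconnected (n : nat) (e : rel 'I_n) : Prop :=
  exists u v : 'I_n, ~~ connect e u v.

(* The vertices of the join are 'I_(n1 + n2), with the first n1 elements
   standing for those of the first graph. *)
Definition join (n1 n2 : nat) (e1 : rel 'I_n1) (e2 : rel 'I_n2) :
    rel 'I_(n1 + n2) :=
  fun u v => match split u, split v with
             | inl i, inl j => e1 i j
             | inr i, inr j => e2 i j
             | _, _ => true
             end.

Section BinomialEdgeIdeal.
Variables (K : fieldType) (n : nat).

(* K[x_u, y_u : u in 'I_n] is {mpoly K[n + n]}, the x's coming first. *)
Definition xvar (u : 'I_n) : {mpoly K[n + n]} := 'X_(lshift n u).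
Definition yvar (u : 'I_n) : {mpoly K[n + n]} := 'X_(rshift n u).

Definition binomial_edge_ideal (e : rel 'I_n) : {mpoly K[n + n]} -> Prop :=
  ideal_gen (fun f => exists u w : 'I_n,
    e u w /\ f = xvar u * yvar w - xvar w * yvar u).

Definition depth_bei (e : rel 'I_n) : nat :=
  depth (@graded_max K (n + n)) (binomial_edge_ideal e).

End BinomialEdgeIdeal.

(* Main.v *)
(* Depth is handled through [depth_ge k I]: some f in m is regular on R/I and
   [depth_ge (k - 1) (I + (f))].  Over a Noetherian ring, prime avoidance gives
   one regular element for finitely many ideals with vanishing socle; this yields
   Rees' theorem and, by cutting all terms down simultaneously, the depth lemma
   for 0 -> R/(I /\ J) -> R/I + R/J -> R/(I + J) -> 0.

   The union of the complete graphs on the classes of a colouring c of W has a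
   toric ideal, so x_v is regular for v in W; adding x_v gives an intersection of
   two smaller ideals, and the depth is |W| + #colours by induction.

   With Q1 = m1 + J_G2, Q2 = m2 + J_G1, Q3 = J_(K_n), one has
   J_G = Q1 /\ Q2 /\ Q3, Q1 + Q3 = m1 + J_(K_n2) and
   Q2 + (Q1 /\ Q3) = m2 + J_(K_n1), of depths n2 + 1 and n1 + 1.  Two uses of the
   depth lemma give the lower bound.  For the upper bound the lemma is silent when
   S/Q2 and S/(Q2 + (Q1 /\ Q3)) have equal depth.  There disconnectedness helps: the
   surjection S1/J_G1 -> S1/J_(K_n1) factors through the ring of a disjoint union
   of two complete graphs, whose depth n1 + 2 is larger. *)
Require Import Defs.
From HB Require Import structures.
From mathcomp Require Import all_boot all_order all_algebra.
From mathcomp Require Import mpoly.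
From mathcomp Require Import ring zify.
From Stdlib Require Import Classical ClassicalEpsilon.
From Stdlib Require Import FunctionalExtensionality PropExtensionality.

Set Implicit Arguments.
Unset Strict Implicit.
Unset Printing Implicit Defensive.

Import GRing.Theory.
Local Open Scope ring_scope.

(** * Ideals and regular elements *)

(** No Ext or local cohomology module is computed. Depth at least one amounts to a vanishing socle,
    which is tested on elements, and a regular element common to all terms reduces every higher
    bound to that case. Since this element comes from prime avoidance rather than from a general
    linear form, finite fields get no separate treatment. The constant n1 + 2 has two sources. A
    larger depth of S/J_G would, by the depth lemma, force depth n1 + 2 on S/(m2 + J_(K_n1)), whose
    depth is n1 + 1. And n1 + 2 is as far as the factorisation through two complete graphs reaches,
    so within this range bounds on the depth of S/J_G pass to S/Q2; for S/Q1 the range is n2 + 2.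
    The assumption n1 <= n2 makes the depth n2 + 1 of S/(Q1 + Q3) large enough for S/(Q1 /\ Q3) to
    inherit from S/Q1 every bound up to n1 + 2. *)

Lemma pred_ext (T : Type) (A B : T -> Prop) : (forall x, A x <-> B x) -> A = B.
Proof.
by move=> AB; apply: functional_extensionality => x; apply: propositional_extensionality.
Qed.

Section Ideals.
Variable R : comNzRingType.
Implicit Types (I J L m A : R -> Prop) (f g h u : R) (s : seq R).

Definition ideal I : Prop :=
  [/\ I 0, forall f g, I f -> I g -> I (f + g) & forall f g, I g -> I (f * g)].

Lemma ideal0 I : ideal I -> I 0. Proof. by case. Qed.
Lemma idealD I f g : ideal I -> I f -> I g -> I (f + g).
Proof. by case=> _ + _; exact. Qed.
Lemma idealM I f g : ideal I -> I g -> I (f * g).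
Proof. by case=> _ _; exact. Qed.
Lemma idealMr I f g : ideal I -> I f -> I (f * g).
Proof. by move=> hI If; rewrite mulrC; apply: idealM. Qed.
Lemma idealN I f : ideal I -> I f -> I (- f).
Proof. by move=> hI If; rewrite -mulN1r; apply: idealM. Qed.
Lemma idealB I f g : ideal I -> I f -> I g -> I (f - g).
Proof. by move=> hI If Ig; apply: idealD => //; apply: idealN. Qed.

Lemma ideal_sum I (k : nat) (F : 'I_k -> R) :
  ideal I -> (forall i, I (F i)) -> I (\sum_(i < k) F i).
Proof.
move=> hI IF; apply: (big_ind I) => [|f g|i _] //; first exact: ideal0.
by move=> ? ?; apply: idealD.
Qed.

Lemma ideal_comb1 I a f h : ideal I -> I f -> h = a * f -> I h.
Proof. by move=> hI If ->; apply: idealM. Qed.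
Lemma ideal_comb2 I a b f g h : ideal I -> I f -> I g -> h = a * f + b * g -> I h.
Proof. by move=> hI If Ig ->; apply: idealD => //; apply: idealM. Qed.

Lemma ideal_gen_ideal A : ideal (ideal_gen A).
Proof.
split.
- exists 0%N, (fun _ => 0), (fun _ => 0); split; first by case.
  by rewrite big_ord0.
- move=> _ _ [k [c [g [Ag ->]]]] [k' [c' [g' [Ag' ->]]]].
  exists (k + k')%N, (fun i => match split i with inl j => c j | inr j => c' j end),
    (fun i => match split i with inl j => g j | inr j => g' j end).
  split; first by move=> i; case: split.
  rewrite big_split_ord /=; congr (_ + _); apply: eq_bigr => i _.
    by rewrite -[lshift _ _]/(unsplit (inl i)) unsplitK.
  by rewrite -[rshift _ _]/(unsplit (inr i)) unsplitK.
- move=> f _ [k [c [g [Ag ->]]]]; exists k, (fun i => f * c i), g; split => //.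
  by rewrite mulr_sumr; apply: eq_bigr => i _; rewrite mulrA.
Qed.

Lemma ideal_gen_in A f : A f -> ideal_gen A f.
Proof.
move=> Af; exists 1%N, (fun _ => 1), (fun _ => f); split=> //.
by rewrite big_ord1 mul1r.
Qed.

Lemma ideal_gen_min A I : ideal I -> (forall f, A f -> I f) ->
  forall f, ideal_gen A f -> I f.
Proof.
move=> hI AI _ [k [c [g [Ag ->]]]]; apply: ideal_sum => // i.
by apply: idealM => //; apply: AI.
Qed.

Definition add_elt I f : R -> Prop := fun h => exists a, I (h - a * f).
Definition ideal_cap I J : R -> Prop := fun h => I h /\ J h.
Definition ideal_add I J : R -> Prop :=
  fun h => exists i j, [/\ I i, J j & h = i + j].

Definition regular I f : Prop := forall g, I (f * g) -> I g.

(* [(I : m) = I], that is, the socle of [R/I] vanishes. *)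
Definition zero_socle m I : Prop :=
  forall u, (forall z, m z -> I (z * u)) -> I u.

Lemma add_elt_sub I f h : ideal I -> I h -> add_elt I f h.
Proof. by move=> hI Ih; exists 0; rewrite mul0r subr0. Qed.

Lemma add_elt_in I f : ideal I -> add_elt I f f.
Proof. by move=> hI; exists 1; rewrite mul1r subrr; apply: ideal0. Qed.

Lemma add_elt_ideal I f : ideal I -> ideal (add_elt I f).
Proof.
move=> hI; split.
- by apply: add_elt_sub => //; apply: ideal0.
- move=> g h [a Ia] [b Ib]; exists (a + b).
  by apply: (ideal_comb2 (a := 1) (b := 1) hI Ia Ib); ring.
- move=> g h [a Ia]; exists (g * a).
  by apply: (ideal_comb1 (a := g) hI Ia); ring.
Qed.

Lemma add_elt_min I J f : ideal J -> (forall h, I h -> J h) -> J f ->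
  forall h, add_elt I f h -> J h.
Proof.
move=> hJ IJ Jf h [a Ia]; rewrite -[h](subrK (a * f)).
by apply: idealD => //; [exact: IJ | exact: idealM].
Qed.

Lemma add_elt_mono I J f : (forall h, I h -> J h) ->
  forall h, add_elt I f h -> add_elt J f h.
Proof. by move=> IJ h [a Ia]; exists a; apply: IJ. Qed.

Lemma add_eltC I f g : add_elt (add_elt I f) g = add_elt (add_elt I g) f.
Proof.
by apply: pred_ext => h; split=> -[a [b Ib]]; exists b, a;
  move: Ib; congr I; ring.
Qed.

Lemma ideal_cap_ideal I J : ideal I -> ideal J -> ideal (ideal_cap I J).
Proof.
move=> hI hJ; split; first by split; apply: ideal0.
  by move=> f g [? ?] [? ?]; split; apply: idealD.
by move=> f g [? ?]; split; apply: idealM.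
Qed.

Lemma ideal_add_ideal I J : ideal I -> ideal J -> ideal (ideal_add I J).
Proof.
move=> hI hJ; split; first by exists 0, 0; rewrite addr0; split=> //; apply: ideal0.
  move=> _ _ [i [j [Ii Jj ->]]] [i' [j' [Ii' Jj' ->]]].
  by exists (i + i'), (j + j'); split; [exact: idealD | exact: idealD | ring].
move=> f _ [i [j [Ii Jj ->]]].
by exists (f * i), (f * j); split; [exact: idealM | exact: idealM | ring].
Qed.

Lemma ideal_addl I J f : ideal J -> I f -> ideal_add I J f.
Proof. by move=> hJ If; exists f, 0; rewrite addr0; split=> //; apply: ideal0. Qed.
Lemma ideal_addr I J f : ideal I -> J f -> ideal_add I J f.
Proof. by move=> hJ If; exists 0, f; rewrite add0r; split=> //; apply: ideal0. Qed.

Lemma ideal_add_min I J L : ideal L -> (forall f, I f -> L f) ->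
  (forall f, J f -> L f) -> forall f, ideal_add I J f -> L f.
Proof.
by move=> hL IL JL _ [i [j [Ii Jj ->]]]; apply: idealD => //; [apply: IL|apply: JL].
Qed.

Lemma add_elt_add I J f : ideal I -> ideal J ->
  ideal_add (add_elt I f) (add_elt J f) = add_elt (ideal_add I J) f.
Proof.
move=> hI hJ; apply: pred_ext => h; split.
  case=> [i [j [[a Ia] [b Jb] ->]]]; exists (a + b).
  by exists (i - a * f), (j - b * f); split=> //; ring.
case=> a [i [j [Ii Jj e]]]; exists (i + a * f), j; split.
- by exists a; rewrite addrK.
- exact: add_elt_sub.
- by rewrite addrAC -e subrK.
Qed.

(* The snake lemma for multiplication by [f] on
   [0 -> R/(I /\ J) -> R/I + R/J -> R/(I + J) -> 0]. *)
Lemma add_elt_cap I J f : ideal I -> ideal J -> regular (ideal_add I J) f ->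
  ideal_cap (add_elt I f) (add_elt J f) = add_elt (ideal_cap I J) f.
Proof.
move=> hI hJ rf; apply: pred_ext => h; split; last first.
  by case=> a [Ia Ja]; split; exists a.
case=> -[a Ia] [b Jb].
have [i [j [Ii Jj e]]] : ideal_add I J (b - a).
  apply: rf; exists (h - a * f), (- (h - b * f)).
  by split=> //; [exact: idealN | ring].
exists (a + i); split.
  by apply: (ideal_comb2 (a := 1) (b := - f) hI Ia Ii); ring.
apply: (ideal_comb2 (a := 1) (b := f) hJ Jb Jj).
by have -> : b = a + i + j by [rewrite -addrA -e addrC subrK]; ring.
Qed.

Lemma regular_zero_socle m I f : m f -> regular I f -> zero_socle m I.
Proof. by move=> mf rf u mu; apply: rf; apply: mu. Qed.

(** From f u = v h modulo I, regularity of h on R/(I + (f)) gives v = w f, and cancelling f leaves u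
    = w h. *)
Lemma regular_swap I f h : ideal I -> regular I f -> regular I h ->
  regular (add_elt I f) h -> regular (add_elt I h) f.
Proof.
move=> hI rf rh rfh u [v Iv].
have [w Iw] : add_elt I f v.
  apply: rfh; exists u.
  by apply: (ideal_comb1 (a := -1) hI Iv); ring.
exists w; apply: rf.
by apply: (ideal_comb2 (a := 1) (b := h) hI Iv Iw); ring.
Qed.

(** Solving f u = v g modulo I carries the socle of R/(I + (g)) to that of R/(I + (f)); both are
    Ext^1(R/m, R/I). This is the germ of Rees' theorem. *)
Lemma zero_socle_exchange m I f g : ideal I -> m f -> m g ->
  regular I f -> regular I g ->
  zero_socle m (add_elt I f) -> zero_socle m (add_elt I g).
Proof.
move=> hI mf mg rf rg sf u mu.
have [v Iv] := mu f mf.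
have [w Iw] : add_elt I f v.
  apply: sf => z mz; have [w Iw] := mu z mz; exists w; apply: rg.
  by apply: (ideal_comb2 (a := - z) (b := f) hI Iv Iw); ring.
exists w; apply: rf.
by apply: (ideal_comb2 (a := 1) (b := g) hI Iv Iw); ring.
Qed.

End Ideals.

(** * Associated primes and prime avoidance *)

Section Noetherian.
Variable R : comNzRingType.
Implicit Types (I J L m P : R -> Prop) (f g h u : R) (s : seq R).

(** The ascending chain condition, phrased for sequences of elements because the basis theorem below
    proves it in that form. *)
Definition noetherian : Prop :=
  forall u : nat -> R,
    exists k, ideal_gen (fun f => exists2 i, (i < k)%N & f = u i) (u k).

(** Without a maximal member, choice builds an ascending chain together with an element new at each
    stage, against [noetherian]. Indexing by T lets a member carry data, such as a regular sequence
    that generates it. *)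
Lemma noetherian_maximal (T : Type) (F : T -> R -> Prop) (t0 : T) :
  noetherian -> (forall t, ideal (F t)) ->
  exists t, forall t', (forall f, F t f -> F t' f) -> forall f, F t' f -> F t f.
Proof.
move=> noeth hF; apply: NNPP => no.
have step t : {p : T * R | [/\ forall f, F t f -> F p.1 f, F p.1 p.2 & ~ F t p.2]}.
  apply: constructive_indefinite_description; apply: NNPP => np; apply: no.
  exists t => t' tt' f Ff; apply: NNPP => nf; apply: np.
  by exists (t', f).
pose v k := iter k (fun t => (sval (step t)).1) t0.
pose w k := (sval (step (v k))).2.
have vw k : [/\ forall f, F (v k) f -> F (v k.+1) f, F (v k.+1) (w k)
              & ~ F (v k) (w k)] by exact: svalP (step (v k)).
have mono k i : forall f, F (v k) f -> F (v (i + k)%N) f.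
  elim: i => [//|i IHi] f Ff; rewrite addSn.
  by have [vi _ _] := vw (i + k)%N; apply/vi/IHi.
have [k] := noeth w.
have [_ _ nw] := vw k; move=> gw; apply: nw.
apply: (ideal_gen_min _ _ gw) => // _ [i ik ->].
by have [_ wi _] := vw i; rewrite -(subnK ik); apply: mono.
Qed.

Definition colon I u : R -> Prop := fun f => I (f * u).

Lemma colon_ideal I u : ideal I -> ideal (colon I u).
Proof.
move=> hI; split; rewrite /colon; first by rewrite mul0r; apply: ideal0.
  by move=> f g If Ig; rewrite mulrDl; apply: idealD.
by move=> f g Ig; rewrite -mulrA; apply: idealM.
Qed.

Definition prime_pred P : Prop := forall f g, P (f * g) -> P f \/ P g.

(** For such u the ideal [colon I u] is an associated prime of R/I: an annihilator maximal among
    those of nonzero elements. *)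
Definition maximal_colon I u : Prop :=
  ~ I u /\ forall v, ~ I v -> (forall f, colon I u f -> colon I v f) ->
    forall f, colon I v f -> colon I u f.

Lemma maximal_colon_prime I u : ideal I -> maximal_colon I u -> prime_pred (colon I u).
Proof.
move=> hI [nu maxu] f g fgu; case: (classic (colon I u f)) => [|nf]; first by left.
right; apply: (maxu (f * u)) => //; last by rewrite /colon mulrA [g * f]mulrC.
by move=> h hu; rewrite /colon mulrCA; apply: idealM.
Qed.

Lemma maximal_colon_above I g : noetherian -> ideal I -> ~ I g ->
  exists2 u, maximal_colon I u & forall f, colon I g f -> colon I u f.
Proof.
move=> noeth hI ng.
pose T := {v : R | ~ I v /\ forall f, colon I g f -> colon I v f}.
have [||[u [nu gu]] maxu] := @noetherian_maximal T (fun t => colon I (sval t)) _ noeth.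
- by exists g.
- by move=> t; apply: colon_ideal.
exists u => //; split=> // v nv uv f vf.
have gv h : colon I g h -> colon I v h by move=> gh; apply/uv/gu.
exact: (maxu (exist _ v (conj nv gv))).
Qed.

Definition add_seq I s : R -> Prop := foldl (@add_elt R) I s.

Lemma add_seq_ideal I s : ideal I -> ideal (add_seq I s).
Proof. by elim: s I => [//|f s IHs] I hI /=; apply/IHs/add_elt_ideal. Qed.

Lemma add_seq_rcons I s f : add_seq I (rcons s f) = add_elt (add_seq I s) f.
Proof. by rewrite /add_seq foldl_rcons. Qed.

Lemma add_seq_min I J s : ideal J -> (forall h, I h -> J h) ->
  (forall f, f \in s -> J f) -> forall h, add_seq I s h -> J h.
Proof.
move=> hJ IJ; elim/last_ind: s => [//|s f IHs] sJ h.
rewrite add_seq_rcons; apply: add_elt_min => //.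
  by apply: IHs => g gs; apply: sJ; rewrite mem_rcons inE gs orbT.
by apply: sJ; rewrite mem_rcons mem_head.
Qed.

Lemma prime_avoid_seq I s u : ideal I -> prime_pred (colon I u) ->
  ~ colon I u 1 ->
  (forall v, v \in s -> exists2 f, colon I v f & ~ colon I u f) ->
  exists2 f, (forall v, v \in s -> colon I v f) & ~ colon I u f.
Proof.
move=> hI pu nu1; elim: s => [|v s IHs] sP; first by exists 1.
have [|f fs nf] := IHs; first by move=> w ws; apply: sP; rewrite inE ws orbT.
have [g gv ng] := sP v (mem_head _ _).
exists (f * g); last by case/pu.
move=> w; rewrite inE => /orP[/eqP->|ws].
  by apply: idealM => //; apply: colon_ideal.
by apply: idealMr; [apply: colon_ideal | apply: fs].
Qed.

(** Among finite lists of elements with maximal annihilator, take s with I + (s) maximal. A zero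
    divisor f lies in some maximal [colon I u], and u lies in I + (s). If f were in no [colon I v]
    with v in s, none of these would be contained in the prime [colon I u], so some product outside
    it would kill s and hence u. *)
Lemma associated_primes I : noetherian -> ideal I ->
  exists2 s : seq R, (forall u, u \in s -> maximal_colon I u) &
    forall f, ~ regular I f -> exists2 u, u \in s & colon I u f.
Proof.
move=> noeth hI.
pose T := {s : seq R | forall u, u \in s -> maximal_colon I u}.
have [||[s maxs] ms] := @noetherian_maximal T (fun t => add_seq I (sval t)) _ noeth.
- by exists [::].
- by move=> t; apply: add_seq_ideal.
exists s => // f; rewrite /regular => nreg.
have [g nfg] := not_all_ex_not _ _ nreg.
have [fg ng] := imply_to_and _ _ nfg.
have [u mu gu] := maximal_colon_above noeth hI ng.
have su : add_seq I s u.
  have hr v : v \in rcons s u -> maximal_colon I v.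
    by rewrite mem_rcons inE => /orP[/eqP->|/maxs].
  apply: (ms (exist _ _ hr)) => /=.
    by move=> h; rewrite add_seq_rcons; apply/add_elt_sub/add_seq_ideal.
  by rewrite add_seq_rcons; apply/add_elt_in/add_seq_ideal.
have [nu maxu] := mu; apply: NNPP => nos.
have [||v vs|h hs nh] := @prime_avoid_seq I s u hI; first exact: maximal_colon_prime.
- by rewrite /colon mul1r.
- have [nv maxv] := maxs v vs.
  apply: NNPP => nh; apply: nos; exists v => //.
  apply: maxv nu _ _ (gu _ fg) => h hv; apply: NNPP => nhu.
  by apply: nh; exists h.
apply: nh; rewrite /colon mulrC.
apply: (@add_seq_min I (colon I h) s) su => //; first exact: colon_ideal.
  by move=> x Ix; rewrite /colon mulrC; apply: idealM.
by move=> v vs; rewrite /colon mulrC; apply: hs.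
Qed.

Lemma prime_product (l : seq (R -> Prop)) P m :
  ideal m -> ideal P -> prime_pred P ->
  (forall Q, List.In Q l -> ideal Q) ->
  (exists2 f, m f & ~ P f) ->
  (forall Q, List.In Q l -> exists2 f, Q f & ~ P f) ->
  exists f, [/\ m f, ~ P f & forall Q, List.In Q l -> Q f].
Proof.
move=> hm hP pP; elim: l => [|Q l IHl] hl [f mf nf] lP; first by exists f.
have [|||g [mg ng gl]] := IHl.
- by move=> Q' Q'l; apply: hl; right.
- by exists f.
- by move=> Q' Q'l; apply: lP; right.
have [h hQ nh] := lP Q (or_introl erefl).
exists (g * h); split.
- exact: idealMr.
- by case/pP.
move=> Q' [<-|Q'l]; first by apply: idealM => //; apply: hl; left.
by apply: idealMr; [apply: hl; right | apply: gl].
Qed.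

(** Induction on the number of primes. A prime contained in P is dropped; if there is none, an f
    that avoids the others but lies in P is corrected by an element of m outside P and inside all
    the others. *)
Lemma prime_avoidance m (l : seq (R -> Prop)) : ideal m ->
  (forall P, List.In P l -> [/\ ideal P, prime_pred P & exists2 f, m f & ~ P f]) ->
  exists2 f, m f & forall P, List.In P l -> ~ P f.
Proof.
move=> hm; have [k] := ubnP (size l).
elim: k l => [//|k IHk] [|P l] /= szl hl; first by exists 0; [exact: ideal0|].
have [hP pP mP] := hl P (or_introl erefl).
case: (classic (exists2 Q, List.In Q l & forall f, Q f -> P f)) => [[Q Ql QP]|noQ].
  have [l1 [l2 el]] := List.in_split _ _ Ql.
  have sub P' : List.In P' (P :: l1 ++ l2) -> List.In P' (P :: l).
    rewrite el /=; case=> [|/(@List.in_app_or _ _ _ _)[?|?]]; [by left| |]; right;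
      apply: List.in_or_app; [by left|by right; right].
  have [||f mf fl] := IHk (P :: l1 ++ l2).
  - by move: szl; rewrite el /= !size_cat /= addnS.
  - by move=> P' /sub /hl.
  exists f => // P' [<-|]; first exact: (fl P (or_introl erefl)).
  rewrite el => /(@List.in_app_or _ _ _ _)[P'l|[<-|P'l]].
  - by apply: (fl P'); right; apply: List.in_or_app; left.
  - by move=> /QP; exact: (fl P (or_introl erefl)).
  - by apply: (fl P'); right; apply: List.in_or_app; right.
have [||f mf fl] := IHk l.
- by [].
- by move=> Q Ql; apply: hl; right.
case: (classic (P f)) => [Pf|nPf]; last by exists f => // Q [<-//|]; apply: fl.
have [|||g [mg ng gl]] := @prime_product l P m hm hP pP.
- by move=> Q Ql; have [] := hl Q (or_intror Ql).
- by [].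
- move=> Q Ql; apply: NNPP => nQ; apply: noQ; exists Q => // h Qh.
  by apply: NNPP => nPh; apply: nQ; exists h.
exists (f + g); first exact: idealD.
move=> Q [<-|Ql] Qfg.
  by apply: ng; rewrite -[g](addKr f) addrC; apply: idealB.
apply: (fl Q Ql); rewrite -[f](addrK g).
by have [hQ _ _] := hl Q (or_intror Ql); apply: idealB => //; apply: gl.
Qed.

(** A vanishing socle means that no [colon I u] with u outside I contains m, so prime avoidance
    applies to the associated primes of all the listed ideals at once. *)
Lemma common_regular m (l : seq (R -> Prop)) : noetherian -> ideal m ->
  (forall I, List.In I l -> ideal I /\ zero_socle m I) ->
  exists2 f, m f & forall I, List.In I l -> regular I f.
Proof.
move=> noeth hm hl.
suff [ps psP psr] : exists2 ps : seq (R -> Prop),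
    (forall P, List.In P ps -> [/\ ideal P, prime_pred P & exists2 f, m f & ~ P f]) &
    forall f, (forall P, List.In P ps -> ~ P f) -> forall I, List.In I l -> regular I f.
  by have [f mf fps] := prime_avoidance hm psP; exists f => //; apply: psr.
elim: l hl => [|I l IHl] hl; first by exists [::].
have [|ps psP psr] := IHl; first by move=> J Jl; apply: hl; right.
have [hI sI] := hl I (or_introl erefl).
have [s maxs sr] := associated_primes noeth hI.
exists (ps ++ [seq colon I u | u <- s]).
  move=> P /(@List.in_app_or _ _ _ _)[/psP//|].
  elim: s {sr} maxs => [//|u s IHs] maxs /= [<-|]; last first.
    by apply: IHs => v vs; apply: maxs; rewrite inE vs orbT.
  have mu := maxs u (mem_head _ _); split; first exact: colon_ideal.
    exact: maximal_colon_prime.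
  have [nu _] := mu; apply: NNPP => nf; apply/nu/sI => z mz.
  by apply: NNPP => nz; apply: nf; exists z.
move=> f fps J [<-|Jl]; last first.
  by apply: psr Jl => P Pps; apply: fps; apply: List.in_or_app; left.
apply: NNPP => /sr[u us uf]; apply: fps uf; apply: List.in_or_app; right.
elim: s us {maxs sr} => [//|v s IHs]; rewrite inE => /orP[/eqP->|/IHs]; first by left.
by right.
Qed.

End Noetherian.

(** * Depth *)

Section DepthGe.
Variables (R : comNzRingType) (m : R -> Prop).
Implicit Types (I J L : R -> Prop) (f g h u : R) (s : seq R).

(** Peeling off the first element suits cutting several quotients down by the same f. No quotient is
    required to be nonzero here; [regular_seq_in_rec] recovers this from I being inside a proper
    m. *)
Fixpoint depth_ge (k : nat) I : Prop :=
  if k is k'.+1 then exists f, [/\ m f, regular I f & depth_ge k' (add_elt I f)]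
  else True.

Definition has_depth I (d : nat) : Prop := forall k, depth_ge k I <-> (k <= d)%N.

Lemma depth_geS k I : depth_ge k.+1 I -> depth_ge k I.
Proof.
by elim: k I => [//|k IHk] I [f [mf rf df]]; exists f; split=> //; apply: IHk.
Qed.

Lemma depth_ge_leq j k I : (j <= k)%N -> depth_ge k I -> depth_ge j I.
Proof.
move=> /subnKC <-; elim: (k - j)%N => [|i IHi]; rewrite ?addn0 //.
by rewrite addnS => /depth_geS.
Qed.

Lemma depth_ge_zero_socle k I : depth_ge k.+1 I -> zero_socle m I.
Proof. by case=> f [mf rf _]; apply: regular_zero_socle rf. Qed.

Hypotheses (noeth : noetherian R) (hm : ideal m).

(* Rees: all maximal regular sequences have the same length. *)
Lemma depth_ge_exchange k I f g : ideal I -> m f -> m g ->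
  regular I f -> regular I g -> depth_ge k (add_elt I f) -> depth_ge k (add_elt I g).
Proof.
elim: k I f g => [//|k IHk] I f g hI mf mg rf rg df.
have sI := regular_zero_socle mf rf.
have sf := depth_ge_zero_socle df.
have sg := zero_socle_exchange hI mf mg rf rg sf.
have hf := add_elt_ideal f hI; have hg := add_elt_ideal g hI.
(* An h regular on all three quotients permits two exchanges by induction: f' for h over I + (f),
   then f for g over I + (h). *)
have [J|h mh rh] := common_regular (l := [:: I; add_elt I f; add_elt I g]) noeth hm.
  by case=> [<-|[<-|[<-|[]]]].
have rI := rh I (or_introl erefl).
have rIf := rh _ (or_intror (or_introl erefl)).
have rIg := rh _ (or_intror (or_intror (or_introl erefl))).
exists h; split=> //; rewrite add_eltC; apply: (IHk _ f) => //.
- exact: add_elt_ideal.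
- exact: regular_swap.
- exact: regular_swap.
case: df => f' [mf' rf' df']; rewrite add_eltC.
exact: (IHk _ f').
Qed.

Lemma depth_ge_add_elt k I f : ideal I -> m f -> regular I f ->
  depth_ge k.+1 I <-> depth_ge k (add_elt I f).
Proof.
move=> hI mf rf; split; last by move=> df; exists f.
by case=> g [mg rg]; apply: depth_ge_exchange.
Qed.

Lemma depth_ge1 I : ideal I -> zero_socle m I -> depth_ge 1 I.
Proof.
move=> hI sI; have [J|f mf rf] := common_regular (l := [:: I]) noeth hm.
  by case=> [<-|[]].
by exists f; split=> //; apply: rf; left.
Qed.

Lemma has_depth_add_elt I f d : ideal I -> m f -> regular I f ->
  has_depth (add_elt I f) d <-> has_depth I d.+1.
Proof.
move=> hI mf rf; split=> hd k.
  by case: k => [//|k]; rewrite (depth_ge_add_elt _ hI mf rf).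
by rewrite -(depth_ge_add_elt _ hI mf rf).
Qed.

(** For k = 1 the condition on the sum is void and the socle of the intersection vanishes with those
    of I and J. Beyond that, a common regular element commutes with the intersection by
    [add_elt_cap]. *)
Lemma depth_ge_cap k I J : ideal I -> ideal J ->
  depth_ge k I -> depth_ge k J -> depth_ge k.-1 (ideal_add I J) ->
  depth_ge k (ideal_cap I J).
Proof.
elim: k I J => [//|k IHk] I J hI hJ dI dJ dIJ.
have sI := depth_ge_zero_socle dI; have sJ := depth_ge_zero_socle dJ.
have hC := ideal_cap_ideal hI hJ; have hA := ideal_add_ideal hI hJ.
have sC : zero_socle m (ideal_cap I J).
  by move=> u mu; split; [apply: sI|apply: sJ] => z /mu[].
case: k IHk dI dJ dIJ => [|k] IHk dI dJ dIJ; first exact: depth_ge1.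
have sA := depth_ge_zero_socle dIJ.
have [K|f mf rf] := common_regular (l := [:: I; J; ideal_add I J; ideal_cap I J]) noeth hm.
  by case=> [<-|[<-|[<-|[<-|[]]]]].
have rI := rf _ (or_introl erefl).
have rJ := rf _ (or_intror (or_introl erefl)).
have rA := rf _ (or_intror (or_intror (or_introl erefl))).
have rC := rf _ (or_intror (or_intror (or_intror (or_introl erefl)))).
apply/(depth_ge_add_elt _ hC mf rC); rewrite -add_elt_cap //.
apply: IHk; [exact: add_elt_ideal..| | |].
- by apply/(depth_ge_add_elt _ hI mf rI).
- by apply/(depth_ge_add_elt _ hJ mf rJ).
- by rewrite add_elt_add //; apply/(depth_ge_add_elt _ hA mf rA).
Qed.

(** In f u = i + j the element i represents, up to sign, the image of u under the snake map from the
    kernel of f on R/(I + J) to R/((I /\ J) + (f)). That map is injective because f is regular on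
    R/I and R/J, and it preserves socles. *)
Lemma zero_socle_add I J f : ideal I -> ideal J -> m f -> regular I f -> regular J f ->
  zero_socle m (add_elt (ideal_cap I J) f) -> zero_socle m (ideal_add I J).
Proof.
move=> hI hJ mf rI rJ sf u mu.
have [i [j [Ii Jj fu]]] := mu f mf.
have [v [Iv Jv]] : add_elt (ideal_cap I J) f i.
  apply: sf => z mz; have [i' [j' [Ii' Jj' zu]]] := mu z mz.
  exists i'; split.
    by apply: (ideal_comb2 (a := z) (b := - f) hI Ii Ii'); ring.
  apply: (ideal_comb2 (a := - z) (b := f) hJ Jj Jj').
  have -> : i = f * u - j by rewrite fu addrK.
  by have -> : i' = z * u - j' by [rewrite zu addrK]; ring.
have Iv' : I v.
  apply: rI.
  by apply: (ideal_comb2 (a := 1) (b := - 1) hI Ii Iv); ring.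
exists v, (u - v); split=> //; last by rewrite addrC subrK.
apply: rJ; rewrite mulrBr fu.
by apply: (ideal_comb2 (a := 1) (b := 1) hJ Jj Jv); ring.
Qed.

(** Upper bounds for the depth of an intersection come from this half of the depth lemma by
    contraposition, as in [has_depth_cap]. *)
Lemma depth_ge_add k I J : ideal I -> ideal J ->
  depth_ge k I -> depth_ge k J -> depth_ge k.+1 (ideal_cap I J) ->
  depth_ge k (ideal_add I J).
Proof.
elim: k I J => [//|k IHk] I J hI hJ dI dJ dC.
have sI := depth_ge_zero_socle dI; have sJ := depth_ge_zero_socle dJ.
have sC := depth_ge_zero_socle dC.
have hC := ideal_cap_ideal hI hJ; have hA := ideal_add_ideal hI hJ.
have sA : zero_socle m (ideal_add I J).
  have [K|f mf rf] := common_regular (l := [:: I; J; ideal_cap I J]) noeth hm.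
    by case=> [<-|[<-|[<-|[]]]].
  have rI := rf _ (or_introl erefl).
  have rJ := rf _ (or_intror (or_introl erefl)).
  have rC := rf _ (or_intror (or_intror (or_introl erefl))).
  apply: (zero_socle_add hI hJ mf rI rJ).
  by apply: (@depth_ge_zero_socle k); apply/(depth_ge_add_elt _ hC mf rC).
have [K|f mf rf] := common_regular (l := [:: I; J; ideal_add I J; ideal_cap I J]) noeth hm.
  by case=> [<-|[<-|[<-|[<-|[]]]]].
have rI := rf _ (or_introl erefl).
have rJ := rf _ (or_intror (or_introl erefl)).
have rA := rf _ (or_intror (or_intror (or_introl erefl))).
have rC := rf _ (or_intror (or_intror (or_intror (or_introl erefl)))).
apply/(depth_ge_add_elt _ hA mf rA); rewrite -add_elt_add //.
apply: IHk; [exact: add_elt_ideal..| | |].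
- by apply/(depth_ge_add_elt _ hI mf rI).
- by apply/(depth_ge_add_elt _ hJ mf rJ).
- by rewrite add_elt_cap //; apply/(depth_ge_add_elt _ hC mf rC).
Qed.

(* In terms of local cohomology: [H^k(R/I) -> H^k(R/(I + J))] is injective when
   [R/(I /\ J)] has depth above [k], but it factors through [H^k(R/L) = 0].
   This settles the case where [R/I] and [R/(I + J)] have the same depth, about
   which the depth lemma says nothing. *)
Lemma depth_ge_through k I J L : ideal I -> ideal J -> ideal L ->
  (forall f, I f -> L f) -> (forall f, L f -> ideal_add I J f) ->
  depth_ge k.+1 L -> depth_ge k (ideal_add I J) -> depth_ge k.+1 (ideal_cap I J) ->
  depth_ge k.+1 I.
Proof.
elim: k I J L => [|k IHk] I J L hI hJ hL IL LA dL dA dC.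
  have sL := depth_ge_zero_socle dL; have sC := depth_ge_zero_socle dC.
  apply: depth_ge1 => // u mu.
  have [i [j [Ii Jj e]]] : ideal_add I J u by apply: LA; apply: sL => z mz; apply/IL/mu.
  rewrite e; apply: idealD => //; suff [] : ideal_cap I J j by [].
  apply: sC => z mz; split; last exact: idealM.
  have -> : z * j = z * u - z * i by rewrite e; ring.
  by apply: idealB => //; [apply: mu | apply: idealM].
have sL := depth_ge_zero_socle dL; have sA := depth_ge_zero_socle dA.
have sC := depth_ge_zero_socle dC.
(* The induction hypothesis, applied to the same ideals with bounds lowered by one, already gives
   R/I positive depth; this makes a common regular element available. *)
have sI : zero_socle m I.
  by apply: (@depth_ge_zero_socle k); apply: (IHk I J L) => //; apply: depth_geS.
have hC := ideal_cap_ideal hI hJ; have hA := ideal_add_ideal hI hJ.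
have [K|f mf rf] := common_regular (l := [:: I; L; ideal_add I J; ideal_cap I J]) noeth hm.
  by case=> [<-|[<-|[<-|[<-|[]]]]].
have rI := rf _ (or_introl erefl).
have rL := rf _ (or_intror (or_introl erefl)).
have rA := rf _ (or_intror (or_intror (or_introl erefl))).
have rC := rf _ (or_intror (or_intror (or_intror (or_introl erefl)))).
apply/(depth_ge_add_elt _ hI mf rI).
apply: (IHk _ (add_elt J f) (add_elt L f)); try exact: add_elt_ideal.
- exact: add_elt_mono.
- by rewrite add_elt_add //; apply: add_elt_mono.
- by apply/(depth_ge_add_elt _ hL mf rL).
- by rewrite add_elt_add //; apply/(depth_ge_add_elt _ hA mf rA).
- by rewrite add_elt_cap //; apply/(depth_ge_add_elt _ hC mf rC).
Qed.

Lemma has_depth_cap I J d : ideal I -> ideal J ->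
  has_depth I d.+1 -> has_depth J d.+1 -> has_depth (ideal_add I J) d ->
  has_depth (ideal_cap I J) d.+1.
Proof.
move=> hI hJ dI dJ dA k; split=> [dC|kd].
  rewrite leqNgt; apply/negP => dk.
  suff : (d.+1 <= d)%N by rewrite ltnn.
  apply/dA/depth_ge_add => //; [exact/dI|exact/dJ|exact: depth_ge_leq dC].
apply: (@depth_ge_leq _ d.+1) => //.
by apply: depth_ge_cap => //; [exact/dI|exact/dJ|exact/dA].
Qed.

Lemma has_depth_self : ~ m 1 -> has_depth m 0.
Proof.
move=> m1 [|k] //; split=> // -[f [mf rf _]].
by case: m1; apply: rf; rewrite mulr1.
Qed.

(** * Comparison with the length of maximal regular sequences *)

Fixpoint regular_rec I s : Prop :=
  if s is f :: s' then [/\ m f, regular I f & regular_rec (add_elt I f) s'] else True.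

Lemma regular_rec_in I s : regular_rec I s -> forall f, f \in s -> m f.
Proof.
elim: s I => [//|f s IHs] I /= [mf _ /IHs sm] g.
by rewrite inE => /orP[/eqP->|/sm].
Qed.

Lemma regular_rec_rcons I s f : regular_rec I (rcons s f) <->
  [/\ regular_rec I s, m f & regular (add_seq I s) f].
Proof.
elim: s I => [|g s IHs] I /=; first by split=> -[].
split=> [[mg rg /IHs[]]|[[mg rg rs] mf rf]]; first by [].
by split=> //; apply/IHs.
Qed.

Lemma depth_ge_regular_rec k I :
  depth_ge k I <-> exists2 s, regular_rec I s & size s = k.
Proof.
elim: k I => [|k IHk] I /=; first by split=> // _; exists [::].
split=> [[f [mf rf /IHk[s rs <-]]]|[[|f s] //= [mf rf rs] [sk]]].
  by exists (f :: s).
by exists f; split=> //; apply/IHk; exists s.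
Qed.

Lemma regular_rec_has_depth I s : ideal I -> regular_rec I s ->
  ~ depth_ge 1 (add_seq I s) -> has_depth I (size s).
Proof.
elim: s I => [|f s IHs] I hI /= rs nd.
  case=> [|k] //; split=> // dk; case: nd.
  exact: (@depth_ge_leq 1 k.+1 I).
case: rs => mf rf rs; apply/(has_depth_add_elt _ hI mf rf).
by apply: IHs => //; apply: add_elt_ideal.
Qed.

(** Take a regular sequence s with I + (s) maximal. A further regular f would already lie in I +
    (s), and cancelling f from f * 1 would put 1 into I + (s), which is inside m. *)
Lemma has_depth_exists I : ideal I -> ~ m 1 -> (forall f, I f -> m f) ->
  exists d, has_depth I d.
Proof.
move=> hI m1 Im.
pose T := {s : seq R | regular_rec I s}.
have [||[s rs] maxs] := @noetherian_maximal R T (fun t => add_seq I (sval t)) _ noeth.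
- by exists [::].
- by move=> t; apply: add_seq_ideal.
exists (size s); apply: regular_rec_has_depth => // -[f [mf rf _]].
have hs := add_seq_ideal s hI.
have rsf : regular_rec I (rcons s f) by apply/regular_rec_rcons.
have sf : add_seq I s f.
  apply: (maxs (exist _ _ rsf)) => /= [h|]; rewrite add_seq_rcons.
    exact: add_elt_sub.
  exact: add_elt_in.
apply: m1; apply: (add_seq_min hm Im _ (h := 1)); last first.
  by apply: rf; rewrite mulr1.
exact: (regular_rec_in rs).
Qed.

Lemma ideal_adjoin0 I : ideal I -> ideal_adjoin I [::] = I.
Proof.
move=> hI; apply: pred_ext => f; split; last by move=> If; apply: ideal_gen_in; left.
by apply: ideal_gen_min => // g [].
Qed.

Lemma ideal_adjoin_cons I f s : ideal I ->
  ideal_adjoin I (f :: s) = ideal_adjoin (add_elt I f) s.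
Proof.
move=> hI; apply: pred_ext => h; split; apply: ideal_gen_min; try exact: ideal_gen_ideal.
- move=> g [Ig|]; first by apply: ideal_gen_in; left; apply: add_elt_sub.
  rewrite inE => /orP[/eqP->|gs]; apply: ideal_gen_in; last by right.
  by left; apply: add_elt_in.
- move=> g [|gs]; last by apply: ideal_gen_in; right; rewrite inE gs orbT.
  apply: add_elt_min; first exact: ideal_gen_ideal.
    by move=> x Ix; apply: ideal_gen_in; left.
  by apply: ideal_gen_in; right; apply: mem_head.
Qed.

Lemma regular_seq_cons I f s : ideal I ->
  regular_seq I (f :: s) <-> regular I f /\ regular_seq (add_elt I f) s.
Proof.
move=> hI; rewrite /regular_seq ideal_adjoin_cons //; split.
  case=> r n1; split.
    by move=> g; have := r 0%N isT g; rewrite /= ideal_adjoin0.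
  by split=> // i si g; have := r i.+1 si g; rewrite /= ideal_adjoin_cons.
case=> rf [r n1]; split=> // -[|i] si g; first by rewrite /= ideal_adjoin0 //; apply: rf.
by rewrite /= ideal_adjoin_cons //; apply: r.
Qed.

Lemma regular_seq_in_rec I s : ideal I -> ~ m 1 -> (forall f, I f -> m f) ->
  regular_seq_in m I s <-> regular_rec I s.
Proof.
move=> hI m1 Im; elim: s I hI Im => [|f s IHs] I hI Im /=.
  by split=> // _; split=> //; split=> //; rewrite ideal_adjoin0 // => /Im.
have hf := add_elt_ideal f hI.
rewrite /regular_seq_in regular_seq_cons //; split.
  case=> ms [rf rs]; have mf := ms f (mem_head _ _); split=> //.
  apply/IHs => //; first exact: add_elt_min.
  by split=> // g gs; apply: ms; rewrite inE gs orbT.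
case=> mf rf /IHs[] //; first exact: add_elt_min.
by move=> ms rs; split=> // g; rewrite inE => /orP[/eqP->|/ms].
Qed.

Lemma depthP I : ideal I -> ~ m 1 -> (forall f, I f -> m f) -> has_depth I (depth m I).
Proof.
move=> hI m1 Im.
have isdP d : is_depth m I d <-> has_depth I d.
  split=> [[[s rs <-] maxs] k|hd].
    rewrite depth_ge_regular_rec; split=> [[t /(regular_seq_in_rec _ hI m1 Im) rt <-]|ks].
      exact: maxs.
    apply/depth_ge_regular_rec/(depth_ge_leq ks)/depth_ge_regular_rec.
    by exists s => //; apply/regular_seq_in_rec.
  split=> [|s /(regular_seq_in_rec _ hI m1 Im) rs].
    have /depth_ge_regular_rec[s rs <-] := (hd d).2 (leqnn _).
    by exists s => //; apply/regular_seq_in_rec.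
  by apply/hd/depth_ge_regular_rec; exists s.
have [d /isdP hd] := has_depth_exists hI m1 Im.
by apply/isdP; apply: epsilon_spec; exists d.
Qed.

End DepthGe.

(** The map phi identifies the two quotients and sends m onto m'; psi serves to lift elements. *)
Lemma depth_ge_preim (R R' : comNzRingType) (phi : {rmorphism R -> R'}) (psi : R' -> R)
    (m : R -> Prop) (m' I : R' -> Prop) k :
  cancel psi phi -> (forall f, m f -> m' (phi f)) -> (forall f, m' f -> m (psi f)) ->
  depth_ge m k (fun f => I (phi f)) <-> depth_ge m' k I.
Proof.
move=> psiK mphi mpsi; elim: k I => [//|k IHk] I /=.
have adjE f : add_elt (fun g => I (phi g)) f = fun g => add_elt I (phi f) (phi g).
  apply: pred_ext => h; split=> -[a].
    by rewrite rmorphB rmorphM; exists (phi a).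
  by exists (psi a); rewrite rmorphB rmorphM psiK.
have regE f : regular (fun g => I (phi g)) f <-> regular I (phi f).
  split=> rf g; last by rewrite rmorphM; apply: rf.
  by have := rf (psi g); rewrite rmorphM psiK.
split=> -[f [mf rf df]].
  exists (phi f); split; [exact: mphi | exact/regE | by apply/IHk; rewrite -adjE].
exists (psi f); split; first exact: mpsi.
  by apply/regE; rewrite psiK.
by rewrite adjE psiK; apply/IHk.
Qed.

(** * Hilbert's basis theorem *)

Lemma sig2_of_ex2 (T : Type) (P Q : T -> Prop) :
  (exists2 x, P x & Q x) -> {x | P x & Q x}.
Proof.
move=> ex; have [|x [Px Qx]] := @constructive_indefinite_description T (fun x => P x /\ Q x).
  by have [x Px Qx] := ex; exists x.
by exists x.
Qed.

(** Each step of phi goes to an index whose value is minimal over a whole tail starting just after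
    the previous index. *)
Lemma nondecreasing_subsequence (a : nat -> nat) :
  exists2 phi : nat -> nat, forall i j, (i < j)%N -> (phi i < phi j)%N &
    forall i j, (i <= j)%N -> (a (phi i) <= a (phi j))%N.
Proof.
have pick N : {i | (N <= i)%N & forall j, (N <= j)%N -> (a i <= a j)%N}.
  apply: sig2_of_ex2.
  suff min n i : (N <= i)%N -> (a i <= n)%N ->
      exists2 i, (N <= i)%N & forall j, (N <= j)%N -> (a i <= a j)%N.
    exact: (min (a N) N).
  elim: n i => [|n IHn] i Ni ain; first by exists i => // j _; lia.
  case: (classic (exists2 j, (N <= j)%N & (a j <= n)%N)) => [[j Nj]|no]; first exact: IHn.
  exists i => // j Nj; rewrite (leq_trans ain) // ltnNge.
  by apply/negP => ajn; apply: no; exists j.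
pose phi := fix phi k := s2val (pick (if k is k'.+1 then (phi k').+1 else 0%N)).
have phiS k : (phi k < phi k.+1)%N by rewrite /=; case: (pick _).
have phi_mono i j : (i <= j)%N -> (phi i <= phi j)%N.
  by move/subnKC <-; elim: (j - i)%N => [|d /leq_trans-> //]; rewrite ?addn0 ?addnS // ltnW.
exists phi => [i j ij|i j /phi_mono ij]; first exact: leq_trans (phiS i) (phi_mono _ _ ij).
have min k : exists2 N, (N <= phi k)%N & forall j, (N <= j)%N -> (a (phi k) <= a j)%N.
  by case: k => [|k] /=; case: (pick _) => x /= Nx xmin; eexists; eauto.
by have [N Ni] := min i; apply; apply: leq_trans ij.
Qed.

(** One coordinate at a time, pass to a subsequence that is nondecreasing in it; the coordinates
    already treated stay so. *)
Lemma dickson (n : nat) (u : nat -> 'X_{1..n}) :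
  exists i j, (i < j)%N /\ (u i <= u j)%MM.
Proof.
suff [phi phi_lt phi_le] : exists2 phi : nat -> nat,
    forall i j, (i < j)%N -> (phi i < phi j)%N &
    forall c, c \in enum 'I_n -> forall i j, (i <= j)%N -> (u (phi i) c <= u (phi j) c)%N.
  exists (phi 0%N), (phi 1%N); split; first exact: phi_lt.
  by apply/mnm_lepP => c; apply: phi_le; rewrite ?mem_enum.
elim: (enum _) => [|c l [phi phi_lt phi_le]]; first by exists id.
have [psi psi_lt psi_le] := nondecreasing_subsequence (fun k => u (phi k) c).
exists (phi \o psi) => [i j /psi_lt/phi_lt//|d]; rewrite inE => /orP[/eqP->|dl] i j ij.
  exact: psi_le.
apply: phi_le => //=; case: (ltngtP i j) ij => // [/psi_lt/ltnW//|-> //].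
Qed.

Section HilbertBasis.
Import Order.TTheory.
Variables (K : fieldType) (n : nat).
Local Notation S := {mpoly K[n]}.

Lemma lead_reduce (f g : S) : f != 0 -> g != 0 -> (mlead g <= mlead f)%MM ->
  exists a, f - a * g = 0 \/ (mlead (f - a * g) < mlead f)%O.
Proof.
move=> f0 g0 gf; set m := (mlead f - mlead g)%MM.
have mg0 : mleadc g != 0 by rewrite mleadc_eq0.
pose c := mleadc f / mleadc g; have c0 : c != 0.
  by rewrite mulf_neq0 ?invr_eq0 ?mleadc_eq0.
have em : (m + mlead g)%MM = mlead f by rewrite submK.
have lead_ag : mlead ((c *: 'X_[m]) * g) = mlead f.
  have X0 : 'X_[m] != 0 :> S.
    by apply/eqP => /(congr1 (mcoeff m))/eqP; rewrite mcoeffX mcoeff0 eqxx oner_eq0.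
  by rewrite -scalerAl mleadZ // mleadM // (mleadXm _ m) em.
exists (c *: 'X_[m]); set h := f - _.
have [->|h0] := eqVneq h 0; [by left|right].
have hf : (mlead h <= mlead f)%O.
  by apply: (le_trans (mleadB_le _ _)); rewrite lead_ag joinxx.
rewrite lt_neqAle hf andbT; apply: contra_neq h0 => e.
have cg : ('X_[m] * g)@_(mlead f) = mleadc g by rewrite -em mulrC mcoeffMX.
by apply/eqP; rewrite -mleadc_eq0 e mcoeffB -scalerAl mcoeffZ cg divfK // subrr.
Qed.

Lemma minimal_lead (P : S -> Prop) : (exists f, P f) ->
  exists2 f, P f & forall g, P g -> ~ (mlead g < mlead f)%O.
Proof.
move=> [f Pf]; apply: NNPP => no.
suff nP m g : mlead g = m -> ~ P g by apply: (nP (mlead f) f).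
elim/(@ltmwf n): m g => m IHm g em Pg; apply: no; exists g => // h Ph.
by rewrite em => /IHm /(_ h erefl).
Qed.

(** If every [u k] were outside the ideal of its predecessors, their union J would not be finitely
    generated. Choose v_k in J outside the ideal of the earlier v's with minimal leading monomial.
    By Dickson's lemma some mlead v_i divides mlead v_j with i < j, and reducing v_j by v_i
    contradicts minimality. *)
Theorem mpoly_noetherian : noetherian S.
Proof.
move=> u; apply: NNPP => no.
pose U k := ideal_gen (fun f => exists2 i, (i < k)%N & f = u i).
have U_mono j k f : (j <= k)%N -> U j f -> U k f.
  move=> jk; apply: ideal_gen_min; first exact: ideal_gen_ideal.
  by move=> _ [i ij ->]; apply: ideal_gen_in; exists i => //; apply: leq_trans jk.
pose J f := exists k, U k f.
have hJ : ideal J.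
  split; first by exists 0%N; apply: ideal0; apply: ideal_gen_ideal.
    move=> f g [k Uf] [l Ug]; exists (maxn k l); apply: idealD; first exact: ideal_gen_ideal.
      by apply: U_mono Uf; rewrite leq_maxl.
    by apply: U_mono Ug; rewrite leq_maxr.
  by move=> f g [k Ug]; exists k; apply: idealM => //; apply: ideal_gen_ideal.
pose T := {s : seq S | forall f, f \in s -> J f}.
pose gen (s : seq S) := ideal_gen (fun f => f \in s).
have next (t : T) : {f | J f /\ ~ gen (sval t) f &
    forall g, J g /\ ~ gen (sval t) g -> ~ (mlead g < mlead f)%O}.
  apply: sig2_of_ex2; apply: (minimal_lead (P := fun f => J f /\ ~ gen (sval t) f)).
  case: t => s /= sJ.
  suff [k Uk] : exists k, forall f, f \in s -> U k f.
    exists (u k); split.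
      by exists k.+1; apply: ideal_gen_in; exists k.
    move=> /(ideal_gen_min (ideal_gen_ideal _) Uk) Ukk.
    by apply: no; exists k.
  elim: s sJ => [|f s IHs] sJ; first by exists 0%N.
  have [|k Uk] := IHs; first by move=> g gs; apply: sJ; rewrite inE gs orbT.
  have [l Uf] := sJ f (mem_head _ _); exists (maxn k l) => g.
  rewrite inE => /orP[/eqP->|/Uk Ug].
    by apply: U_mono Uf; rewrite leq_maxr.
  by apply: U_mono Ug; rewrite leq_maxl.
have stepP (t : T) f : f \in rcons (sval t) (s2val (next t)) -> J f.
  rewrite mem_rcons inE => /orP[/eqP->|]; last exact: (svalP t).
  by case: (s2valP (next t)).
have nilP (f : S) : f \in [::] -> J f by [].
pose t0 : T := exist (fun s : seq S => forall f, f \in s -> J f) [::] nilP.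
pose t k := iter k (fun t : T => exist (fun s : seq S => forall f, f \in s -> J f) _ (@stepP t)) t0.
pose v k := s2val (next (t k)).
have vt i j : (i < j)%N -> v i \in sval (t j).
  move/subnKC <-; elim: (j - i.+1)%N => [|d IHd].
    by rewrite addn0 /= mem_rcons mem_head.
  by rewrite addnS /= mem_rcons inE IHd orbT.
have [i [j [ij lij]]] := dickson (fun k => mlead (v k)).
have v0 k : v k != 0.
  apply/eqP => vk0; have [_ []] := s2valP (next (t k)).
  by rewrite -/(v k) vk0; apply: ideal0; apply: ideal_gen_ideal.
have [[Jvj nvj] min] := (s2valP (next (t j)), s2valP' (next (t j))).
have [Jvi _] := s2valP (next (t i)).
have gi : gen (sval (t j)) (v i) by apply: ideal_gen_in; apply: vt.
have hg : ideal (gen (sval (t j))) by exact: ideal_gen_ideal.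
have [a ha] := lead_reduce (v0 j) (v0 i) lij.
have nr : ~ gen (sval (t j)) (v j - a * v i).
  move=> gr; apply: nvj; rewrite -/(v j) -[v j](subrK (a * v i)).
  by apply: idealD => //; apply: idealM.
case: ha => [r0|]; first by apply: nr; rewrite r0; apply: ideal0.
by apply: min; split=> //; apply: idealB => //; apply: idealM.
Qed.

End HilbertBasis.

(** * Morphisms from polynomial rings *)

Section UniversalProperty.
Variables (K : fieldType) (N : nat) (R' : comNzRingType).

Lemma mpoly_rmorph_ext (f g : {rmorphism {mpoly K[N]} -> R'}) :
  (forall c, f c%:MP = g c%:MP) -> (forall i, f 'X_i = g 'X_i) -> f =1 g.
Proof.
move=> fgC fgX p; rewrite [p]mpolyE !rmorph_sum; apply: eq_bigr => m _.
rewrite -mul_mpolyC !rmorphM fgC mpolyXE_id !rmorph_prod; congr (_ * _).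
by apply: eq_bigr => i _; rewrite !rmorphXn fgX.
Qed.

Lemma mpoly_rmorph_exists (g : {rmorphism K -> R'}) (h : 'I_N -> R') :
  {phi : {rmorphism {mpoly K[N]} -> R'} |
    (forall c, phi c%:MP = g c) /\ forall i, phi 'X_i = h i}.
Proof.
exists (GRing.RMorphism.clone _ _ (mmap g h) _); split=> [c|i] /=.
  by rewrite mmapC.
by rewrite mmapX mmap1U.
Qed.

End UniversalProperty.

Section FreeVariable.
Variables (K : fieldType) (N : nat) (z : 'I_N).
Local Notation S := {mpoly K[N]}.

Definition free_var_val (i : 'I_N) : {poly S} := if i == z then 'X else ('X_i)%:P.

Definition const_poly : {rmorphism K -> {poly S}} :=
  GRing.RMorphism.clone _ _ (polyC \o @mpolyC N K) _.

(** Expansion in powers of x_z. The coefficients are kept in S, though x_z no longer occurs in them,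
    so that no ring on fewer variables appears. *)
Definition as_poly : {rmorphism S -> {poly S}} :=
  sval (mpoly_rmorph_exists const_poly free_var_val).

Lemma as_polyC c : as_poly c%:MP = (c%:MP)%:P.
Proof. exact: (svalP (mpoly_rmorph_exists const_poly free_var_val)).1. Qed.

Lemma as_polyX i : as_poly 'X_i = free_var_val i.
Proof. exact: (svalP (mpoly_rmorph_exists const_poly free_var_val)).2. Qed.

Lemma as_polyK f : (as_poly f).['X_z] = f.
Proof.
pose ev : {rmorphism S -> S} := GRing.RMorphism.clone _ _ (horner_eval 'X_z \o as_poly) _.
rewrite -[LHS]/(ev f) (@mpoly_rmorph_ext _ _ _ ev idfun) // => [c|i].
  by rewrite /= /horner_eval as_polyC hornerC.
rewrite /= /horner_eval as_polyX /free_var_val.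
by case: eqP => [->|_]; rewrite ?hornerX ?hornerC.
Qed.

(** Generators free of x_z turn membership into a condition on each coefficient of [as_poly], and
    multiplication by x_z merely shifts the coefficients. *)
Lemma regular_free_var (A : S -> Prop) :
  (forall f, A f -> as_poly f = f%:P) -> regular (ideal_gen A) 'X_z.
Proof.
move=> Afree f zf.
have hI : ideal (ideal_gen A) by exact: ideal_gen_ideal.
have hC : ideal (fun g => forall k, ideal_gen A (as_poly g)`_k).
  split=> [k|h h' Ih Ih' k|h h' Ih' k].
  - by rewrite rmorph0 coef0; apply: ideal0.
  - by rewrite rmorphD coefD; apply: idealD.
  - by rewrite rmorphM coefM; apply: ideal_sum => // j; apply: idealM.
have coefI : forall g, ideal_gen A g -> forall k, ideal_gen A (as_poly g)`_k.
  apply: (ideal_gen_min hC) => h Ah k; rewrite Afree // coefC; case: eqP => _.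
    exact: ideal_gen_in.
  exact: ideal0.
rewrite -[f]as_polyK horner_coef; apply: ideal_sum => // k; apply: idealMr => //.
have := coefI _ zf k.+1.
by rewrite rmorphM as_polyX /free_var_val eqxx coefXM.
Qed.

End FreeVariable.

(** * Ideals generated by variables and edge binomials *)

Lemma split_lshift (p q : nat) (u : 'I_p) : split (lshift q u) = inl u.
Proof. exact: (unsplitK (inl u)). Qed.

Lemma split_rshift (p q : nat) (u : 'I_q) : split (rshift p u) = inr u.
Proof. exact: (unsplitK (inr u)). Qed.

Section BinomialIdeals.
Variables (K : fieldType) (n : nat).
Local Notation S := {mpoly K[n + n]}.
Implicit Types (u v w : 'I_n) (i : 'I_(n + n)) (Z : pred 'I_(n + n)) (r e : rel 'I_n).
Implicit Types (W C : {set 'I_n}) (c : 'I_n -> 'I_n).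

Definition edge_binomial u w : S := xvar K u * yvar K w - xvar K w * yvar K u.

Definition vertex i : 'I_n := match split i with inl u => u | inr u => u end.

Lemma vertex_lshift u : vertex (lshift n u) = u.
Proof. by rewrite /vertex split_lshift. Qed.

Lemma vertex_rshift u : vertex (rshift n u) = u.
Proof. by rewrite /vertex split_rshift. Qed.

Definition vertexE := (vertex_lshift, vertex_rshift).

Variant ord_split_spec : 'I_(n + n) -> Type :=
| OrdX u : ord_split_spec (lshift n u)
| OrdY u : ord_split_spec (rshift n u).

Lemma ord_splitP i : ord_split_spec i.
Proof. by rewrite -[i]splitK; case: split => u; constructor. Qed.

(** This shape is stable under killing further variables and covers edge ideals, clique ideals and
    the half-clique ideals below. *)
Definition var_edge_ideal Z r : S -> Prop :=
  ideal_gen (fun f => (exists2 i, Z i & f = 'X_i) \/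
                      (exists u w, r u w /\ f = edge_binomial u w)).

Lemma var_edge_ideal_ideal Z r : ideal (var_edge_ideal Z r).
Proof. exact: ideal_gen_ideal. Qed.

Hint Resolve var_edge_ideal_ideal : core.

Lemma var_edge_ideal_var Z r i : Z i -> var_edge_ideal Z r 'X_i.
Proof. by move=> Zi; apply: ideal_gen_in; left; exists i. Qed.

Lemma var_edge_ideal_edge Z r u w : r u w -> var_edge_ideal Z r (edge_binomial u w).
Proof. by move=> ruw; apply: ideal_gen_in; right; exists u, w. Qed.

Lemma var_edge_ideal_min Z r (I : S -> Prop) : ideal I ->
  (forall i, Z i -> I 'X_i) -> (forall u w, r u w -> I (edge_binomial u w)) ->
  forall f, var_edge_ideal Z r f -> I f.
Proof.
move=> hI ZI rI; apply: ideal_gen_min => // _ [[i Zi ->]|[u [w [ruw ->]]]].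
  exact: ZI.
exact: rI.
Qed.

Lemma edge_binomial_var (I : S -> Prop) u w : ideal I ->
  I (xvar K u) -> I (xvar K w) -> I (edge_binomial u w).
Proof.
move=> hI Iu Iw.
by apply: (ideal_comb2 (a := yvar K w) (b := - yvar K u) hI Iu Iw); rewrite /edge_binomial; ring.
Qed.

Lemma edge_binomial_vertex (I : S -> Prop) u w : ideal I ->
  I (xvar K u) -> I (yvar K u) -> I (edge_binomial u w).
Proof.
move=> hI Iu Iw.
by apply: (ideal_comb2 (a := yvar K w) (b := - xvar K w) hI Iu Iw); rewrite /edge_binomial; ring.
Qed.

Lemma edge_binomialN u w : edge_binomial u w = - edge_binomial w u.
Proof. by rewrite /edge_binomial; ring. Qed.

Lemma var_edge_ideal_regular Z r z : ~~ Z z ->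
  (forall u w, r u w -> vertex z != u /\ vertex z != w) ->
  regular (var_edge_ideal Z r) 'X_z.
Proof.
move=> nZz rz; apply: regular_free_var => f.
have fixX i : i != z -> as_poly K z 'X_i = ('X_i)%:P.
  by move=> iz; rewrite as_polyX /free_var_val (negbTE iz).
case=> [[i Zi ->]|[u [w [/rz[zu zw] ->]]]].
  by apply: fixX; apply: contraTneq Zi => ->.
have nl v : vertex z != v -> lshift n v != z.
  by apply: contraNneq => <-; rewrite vertexE.
have nr v : vertex z != v -> rshift n v != z.
  by apply: contraNneq => <-; rewrite vertexE.
rewrite /edge_binomial /xvar /yvar rmorphB !rmorphM /= !fixX ?nl ?nr //.
by rewrite !polyCB !polyCM.
Qed.

(* [J_H + (x_u, y_u : u \notin W)], where [H] is the subgraph of [e] induced on [W]. *)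
Definition induced_ideal W e : S -> Prop :=
  var_edge_ideal (fun i => vertex i \notin W) (fun u w => [&& u \in W, w \in W & e u w]).

(* The graph here is a disjoint union of complete graphs, the classes of [c] on [W]. *)
Definition clique_ideal W c : S -> Prop := induced_ideal W (fun u w => c u == c w).

Lemma clique_ideal_ideal W c : ideal (clique_ideal W c).
Proof. exact: var_edge_ideal_ideal. Qed.

Hint Resolve clique_ideal_ideal : core.

(** * Toric presentation of a disjoint union of complete graphs *)

Section Toric.
Variables (W : {set 'I_n}) (c : 'I_n -> 'I_n).

(* [x_u |-> z_u s_(c u)] and [y_u |-> z_u t_(c u)] *)
Definition toric_exp i : 'X_{1..n + (n + n)} :=
  (U_(lshift (n + n) (vertex i)) +
   U_(rshift n (match split i with inl u => lshift n (c u) | inr u => rshift n (c u) end)))%MM.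

Definition toric_val i : {mpoly K[n + (n + n)]} :=
  if vertex i \in W then 'X_[toric_exp i] else 0.

Definition toric_map : {rmorphism S -> {mpoly K[n + (n + n)]}} :=
  sval (mpoly_rmorph_exists (@mpolyC (n + (n + n)) K) toric_val).

Lemma toric_mapC a : toric_map a%:MP = a%:MP.
Proof. exact: (svalP (mpoly_rmorph_exists _ toric_val)).1. Qed.

Lemma toric_mapX i : toric_map 'X_i = toric_val i.
Proof. exact: (svalP (mpoly_rmorph_exists _ toric_val)).2. Qed.

Definition toric_mexp (m : 'X_{1..n + n}) : 'X_{1..n + (n + n)} :=
  (\sum_(i < n + n) toric_exp i *+ m i)%MM.

Definition msupported (m : 'X_{1..n + n}) : bool :=
  [forall i, (m i != 0%N) ==> (vertex i \in W)].

Lemma toric_mapXm m : toric_map 'X_[m] = if msupported m then 'X_[toric_mexp m] else 0.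
Proof.
rewrite mpolyXE_id rmorph_prod; case: ifPn => [/forallP sm|].
  rewrite -mprodXnE; apply: eq_bigr => i _; rewrite rmorphXn /= toric_mapX /toric_val.
  by have := sm i; case: (m i) => [|k] /=; rewrite ?expr0 // => ->.
rewrite negb_forall => /existsP[i]; rewrite negb_imply => /andP[mi /negbTE iW].
by rewrite (bigD1 i) //= rmorphXn /= toric_mapX /toric_val iW expr0n (negbTE mi) mul0r.
Qed.

Lemma toric_mexp_vertex m u :
  toric_mexp m (lshift (n + n) u) = (m (lshift n u) + m (rshift n u))%N.
Proof.
rewrite mnm_sumE big_split_ord /=; congr (_ + _)%N; rewrite (bigD1 u) //= big1.
all: rewrite ?mulmnE ?mnmDE ?mnm1E ?vertexE ?eq_lshift ?eq_rlshift ?eqxx ?addn0 ?mul1n //.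
all: move=> w wu; rewrite mulmnE mnmDE !mnm1E vertexE eq_lshift eq_rlshift addn0.
all: by rewrite (negbTE wu) mul0n.
Qed.

Lemma toric_mexp_color m a :
  toric_mexp m (rshift n (lshift n a)) = (\sum_(u | c u == a) m (lshift n u))%N.
Proof.
rewrite mnm_sumE big_split_ord /= [X in (_ + X)%N]big1 => [|u _].
  rewrite addn0 big_mkcond [RHS]big_mkcond; apply: eq_bigr => u _.
  rewrite mulmnE mnmDE !mnm1E split_lshift.
  by rewrite eq_lrshift eq_rshift eq_lshift add0n; case: eqP; rewrite ?mul1n.
rewrite mulmnE mnmDE !mnm1E split_rshift.
by rewrite eq_lrshift eq_rshift eq_rlshift.
Qed.

(** Induction on the total excess of the x-exponents of m over those of m'. If x_u is too frequent
    in m, equal colour sums give a w of the same colour with x_w too rare, and equal degrees at w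
    then put y_w into m; the binomial of u and w trades x_u y_w for x_w y_u. Without excess the sums
    force m = m'. *)
Lemma clique_congr m m' : msupported m -> msupported m' ->
  (forall u, (m (lshift n u) + m (rshift n u) = m' (lshift n u) + m' (rshift n u))%N) ->
  (forall a, (\sum_(u | c u == a) m (lshift n u) = \sum_(u | c u == a) m' (lshift n u))%N) ->
  clique_ideal W c ('X_[m] - 'X_[m']).
Proof.
move=> sm sm'; have [k] := ubnP (\sum_u (m (lshift n u) - m' (lshift n u)))%N.
elim: k m sm => [//|k IHk] m sm Dk deg col.
have [/forallP le|] := boolP [forall u, m (lshift n u) <= m' (lshift n u)]%N.
  have eqx u : m (lshift n u) = m' (lshift n u).
    have := leqif_sum (P := fun w => c w == c u) (fun w _ => leqif_eq (le w)).
    rewrite col => -[_]; rewrite eqxx => /esym/forall_inP/(_ u (eqxx _))/eqP //.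
  have -> : m = m'.
    apply/mnmP => i; case: (ord_splitP i) => u; first exact: eqx.
    by have := deg u; rewrite eqx => /addnI.
  by rewrite subrr; apply: ideal0.
rewrite negb_forall => /existsP[u]; rewrite -ltnNge => mu.
have [w cw mw] : exists2 w, c w == c u & (m (lshift n w) < m' (lshift n w))%N.
  apply/exists_inP; apply: contraLR mu; rewrite negb_exists_in -leqNgt => /forall_inP le.
  have := leqif_sum (P := fun w => c w == c u)
    (fun w cw => leqif_eq (etrans (leqNgt _ _) (le w cw))).
  rewrite col => -[_]; rewrite eqxx => /esym/forall_inP/(_ u (eqxx _))/eqP ->.
  exact: leqnn.
have mwy : (0 < m (rshift n w))%N by have := deg w; lia.
have uw : u != w by apply: contraTneq mu => ->; lia.
have uW : u \in W.
  have := forallP sm (lshift n u); rewrite vertexE; case: (m _) mu => //.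
have wW : w \in W.
  have := forallP sm (rshift n w); rewrite vertexE; case: (m _) mwy => //.
pose d := (U_(lshift n u) + U_(rshift n w))%MM : 'X_{1..n + n}.
pose d' := (U_(lshift n w) + U_(rshift n u))%MM : 'X_{1..n + n}.
pose m0 := (m - d)%MM.
have m0d : m = (m0 + d)%MM.
  rewrite submK //; apply/mnm_lepP => i; rewrite mnmDE !mnm1E.
  case: (ord_splitP i) => v; rewrite ?eq_lshift ?eq_rlshift ?eq_lrshift ?eq_rshift.
    by rewrite addn0; case: eqP => [<-|//]; lia.
  by rewrite add0n; case: eqP => [<-|//]; lia.
have d'x v : d' (lshift n v) = (w == v) by rewrite mnmDE !mnm1E eq_lshift eq_rlshift addn0.
have d'y v : d' (rshift n v) = (u == v) by rewrite mnmDE !mnm1E eq_rshift eq_lrshift.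
have dx v : d (lshift n v) = (u == v) by rewrite mnmDE !mnm1E eq_lshift eq_rlshift addn0.
have dy v : d (rshift n v) = (w == v) by rewrite mnmDE !mnm1E eq_rshift eq_lrshift.
have m0E i : (m i = m0 i + d i)%N by rewrite {1}m0d mnmDE.
have -> : 'X_[m] - 'X_[m'] = 'X_[m0] * edge_binomial u w + ('X_[m0 + d'] - 'X_[m']) :> S.
  rewrite {1}m0d !mpolyXD /edge_binomial /xvar /yvar; ring.
apply: idealD => //.
  by apply: idealM => //; apply: var_edge_ideal_edge; rewrite uW wW eq_sym.
apply: IHk => [|||a].
- apply/forallP => i; apply/implyP; rewrite mnmDE.
  have := forallP sm i; rewrite m0E.
  case: (ord_splitP i) => v; rewrite vertexE ?d'x ?d'y ?dx ?dy.
    by case: (eqVneq w v) => [<-//|_]; case: (m0 _) => [|j] //=.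
  by case: (eqVneq u v) => [<-//|_]; case: (m0 _) => [|j] //=.
- rewrite ltnS in Dk; apply: leq_trans Dk.
  rewrite (bigD1 u) // [X in (_ < X)%N](bigD1 u) //= -addSn leq_add //.
    have := m0E (lshift n u); rewrite mnmDE dx d'x eqxx eq_sym (negbTE uw); lia.
  apply: leq_sum => v vu; have := m0E (lshift n v); rewrite mnmDE dx d'x eq_sym (negbTE vu).
  by case: eqP => [<-|_]; lia.
- by move=> v; rewrite -deg !m0E dx dy !(mnmDE _ m0 d') d'x d'y; lia.
rewrite -col; under eq_bigr do rewrite mnmDE d'x.
under [RHS]eq_bigr do rewrite m0E dx.
rewrite !big_split /=; congr (_ + _)%N.
rewrite !(big_mkcond (fun v => c v == a)) /=.
have delta v0 : (\sum_v (if c v == a then (v0 == v : nat) else 0) = (c v0 == a))%N.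
  rewrite (bigD1 v0) //= big1 => [|v vv0]; first by rewrite eqxx addn0; case: (c v0 == a).
  by rewrite (eq_sym v0) (negbTE vv0); case: ifP.
by rewrite !delta (eqP cw).
Qed.

Lemma clique_ideal_toric0 f : clique_ideal W c f -> toric_map f = 0.
Proof.
have hker : ideal (fun f => toric_map f = 0).
  split=> [|g h g0 h0|g h h0]; first exact: rmorph0.
    by rewrite rmorphD /= g0 h0 addr0.
  by rewrite rmorphM /= h0 mulr0.
apply: (var_edge_ideal_min hker) => [i|u w /and3P[uW wW /eqP cuw]].
  by rewrite toric_mapX /toric_val => /negbTE ->.
rewrite /edge_binomial /xvar /yvar rmorphB !rmorphM /= !toric_mapX /toric_val !vertexE uW wW.
rewrite -!mpolyXD; apply/eqP; rewrite subr_eq0; apply/eqP; congr 'X_[_].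
rewrite /toric_exp !vertexE !split_lshift !split_rshift cuw.
by apply/mnmP => i; rewrite !mnmDE; lia.
Qed.

(** Monomials map to monomials or to 0, so a supported monomial m of f can cancel only against
    another m' with the same image. Subtracting a multiple of ['X_[m] - 'X_[m']], which is in the
    ideal by [clique_congr], shortens f. Unsupported monomials lie in the ideal themselves. *)
Lemma toric0_clique_ideal f : toric_map f = 0 -> clique_ideal W c f.
Proof.
have [k] := ubnP (size (msupp f)); elim: k f => [//|k IHk] f szf f0.
have [->|nzf] := eqVneq f 0; first exact: ideal0.
have [m mf] : exists m, m \in msupp f by exists (mlead f); apply: mlead_supp.
have szr : (size (msupp (f - f@_m *: 'X_[m])) < k)%N.
  rewrite (perm_size (msupp_rem f m)) size_rem //.
  by move: szf; case: (msupp f) mf => //= a l _; rewrite !ltnS.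
have mapZ a m' : toric_map (a *: 'X_[m']) = a%:MP * toric_map 'X_[m'].
  by rewrite -mul_mpolyC rmorphM /= toric_mapC.
have [sm|nsm] := boolP (msupported m); last first.
  rewrite -[f](subrK (f@_m *: 'X_[m])); apply: idealD => //.
    by apply: IHk => //; rewrite rmorphB /= f0 mapZ toric_mapXm (negbTE nsm) mulr0 subrr.
  rewrite -mul_mpolyC; apply: idealM => //.
  move: nsm; rewrite negb_forall => /existsP[i]; rewrite negb_imply => /andP[mi iW].
  have -> : m = (m - U_(i) + U_(i))%MM by rewrite submK // lep1mP.
  rewrite mpolyXD; apply: idealM => //; exact: var_edge_ideal_var.
have [m' [m'f mm' sm' em]] : exists m', [/\ m' \in msupp f, m' != m, msupported m'
                                     & toric_mexp m' = toric_mexp m].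
  apply: NNPP => no; have := mf; rewrite mcoeff_msupp => /eqP; apply.
  have fE : toric_map f = \sum_(m' <- msupp f) (f@_m')%:MP * toric_map 'X_[m'].
    by rewrite {1}[f]mpolyE rmorph_sum; apply: eq_bigr => m' _; rewrite mapZ.
  have := congr1 (mcoeff (toric_mexp m)) f0; rewrite fE raddf_sum mcoeff0 => <-.
  rewrite (bigD1_seq m) ?msupp_uniq //=.
  rewrite mcoeffCM toric_mapXm sm mcoeffX eqxx mulr1.
  rewrite big1_seq ?addr0 // => m' /andP[mm' m'f].
  rewrite mcoeffCM toric_mapXm; case: ifPn => sm'; last by rewrite mcoeff0 mulr0.
  rewrite mcoeffX; case: eqP => [em|]; last by rewrite mulr0.
  by case: no; exists m'.
set g := f - f@_m *: ('X_[m] - 'X_[m']).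
have gE : g = f - f@_m *: 'X_[m] + f@_m *: 'X_[m'] by rewrite /g scalerBr opprB addrA addrAC.
rewrite -[f](subrK (f@_m *: ('X_[m] - 'X_[m']))); apply: idealD => //; last first.
  rewrite -mul_mpolyC; apply: idealM => //; apply: clique_congr => // [u|a].
    by rewrite -!toric_mexp_vertex em.
  by rewrite -!toric_mexp_color em.
apply: IHk; last first.
  by rewrite -/g gE rmorphD rmorphB /= f0 !mapZ !toric_mapXm sm sm' em sub0r addNr.
apply: leq_ltn_trans szr; rewrite -/g gE; apply: uniq_leq_size; first exact: msupp_uniq.
move=> m1 /msuppD_le; rewrite mem_cat => /orP[//|/msuppZ_le].
rewrite msuppX inE => /eqP->; rewrite (perm_mem (msupp_rem f m)).
by rewrite mem_rem_uniq ?msupp_uniq // inE mm'.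
Qed.

(** The quotient embeds into a polynomial ring, a domain, and x_u goes to a nonzero monomial. *)
Lemma clique_ideal_regular u : u \in W -> regular (clique_ideal W c) (xvar K u).
Proof.
move=> uW f /clique_ideal_toric0; rewrite rmorphM /= toric_mapX /toric_val vertexE uW.
move=> /eqP; rewrite mulf_eq0 => /orP[|/eqP/toric0_clique_ideal //].
move=> /eqP/(congr1 (mcoeff (toric_exp (lshift n u))))/eqP.
by rewrite mcoeffX mcoeff0 eqxx oner_eq0.
Qed.

End Toric.
End BinomialIdeals.

(** * Depth for disjoint unions of complete graphs *)

Section GradedMaximal.
Variables (K : fieldType) (N : nat).
Local Notation m := (@graded_max K N).

Lemma graded_max_ideal : ideal m. Proof. exact: ideal_gen_ideal. Qed.

Lemma graded_max_var i : m 'X_i.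
Proof. by apply: ideal_gen_in; exists i. Qed.

Lemma graded_max_min (I : {mpoly K[N]} -> Prop) : ideal I ->
  (forall i, I 'X_i) -> forall f, m f -> I f.
Proof. by move=> hI IX; apply: ideal_gen_min => // _ [i ->]. Qed.

Lemma graded_max_proper : ~ m 1.
Proof.
have [ev [_ evX]] := mpoly_rmorph_exists (N := N) (idfun : {rmorphism K -> K}) (fun _ => 0).
have hker : ideal (fun f => ev f = 0).
  split=> [|g h g0 h0|g h h0]; first exact: rmorph0.
    by rewrite rmorphD /= g0 h0 addr0.
  by rewrite rmorphM /= h0 mulr0.
by move=> /(graded_max_min hker evX)/eqP; rewrite rmorph1 oner_eq0.
Qed.

End GradedMaximal.

Section CliqueDepth.
Variables (K : fieldType) (n : nat).
Local Notation S := {mpoly K[n + n]}.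
Local Notation m := (@graded_max K (n + n)).
Implicit Types (u v w : 'I_n) (i : 'I_(n + n)) (Z : pred 'I_(n + n)) (r e : rel 'I_n).
Implicit Types (W C : {set 'I_n}) (c : 'I_n -> 'I_n).

Hint Resolve var_edge_ideal_ideal graded_max_ideal : core.

Lemma noetherian_S : noetherian S. Proof. exact: mpoly_noetherian. Qed.
Hint Resolve noetherian_S : core.

Lemma xvar_graded_max u : m (xvar K u). Proof. exact: graded_max_var. Qed.
Lemma yvar_graded_max u : m (yvar K u). Proof. exact: graded_max_var. Qed.
Hint Resolve xvar_graded_max yvar_graded_max graded_max_var : core.

Lemma var_edge_ideal_sub_max Z r f : var_edge_ideal Z r f -> m f.
Proof. by apply: var_edge_ideal_min => // u w _; apply: edge_binomial_var. Qed.

Lemma eq_var_edge_ideal Z Z' r r' : Z =1 Z' -> r =2 r' ->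
  var_edge_ideal (K := K) Z r = var_edge_ideal Z' r'.
Proof.
move=> eZ er; apply: pred_ext => f; split.
  apply: var_edge_ideal_min => // [i|u w].
    by rewrite eZ; apply: var_edge_ideal_var.
  by rewrite er; apply: var_edge_ideal_edge.
apply: var_edge_ideal_min => // [i|u w].
  by rewrite -eZ; apply: var_edge_ideal_var.
by rewrite -er; apply: var_edge_ideal_edge.
Qed.

Lemma var_edge_ideal_add_var Z r z :
  add_elt (var_edge_ideal (K := K) Z r) 'X_z = var_edge_ideal (fun i => Z i || (i == z)) r.
Proof.
apply: pred_ext => f; split.
  apply: add_elt_min => //; last by apply: var_edge_ideal_var; rewrite eqxx orbT.
  apply: var_edge_ideal_min => // [i Zi|u w ruw]; last exact: var_edge_ideal_edge.
  by apply: var_edge_ideal_var; rewrite Zi.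
apply: var_edge_ideal_min; first exact: add_elt_ideal.
  move=> i /orP[Zi|/eqP->]; last exact: add_elt_in.
  by apply: add_elt_sub => //; apply: var_edge_ideal_var.
by move=> u w ruw; apply: add_elt_sub => //; apply: var_edge_ideal_edge.
Qed.

Lemma has_depth_free_vars Z r (s : seq 'I_(n + n)) d : uniq s ->
  (forall z, z \in s -> ~~ Z z) ->
  (forall z u w, z \in s -> r u w -> vertex z != u /\ vertex z != w) ->
  has_depth m (var_edge_ideal (fun i => Z i || (i \in s)) r) d ->
  has_depth m (var_edge_ideal Z r) (size s + d).
Proof.
elim: s Z => [|z s IHs] Z /=.
  move=> _ _ _; congr has_depth; apply: eq_var_edge_ideal => // i.
  by rewrite in_nil orbF.
move=> /andP[zs us] nZ rs hd.
have rz : regular (var_edge_ideal (K := K) Z r) 'X_z.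
  apply: var_edge_ideal_regular; first by apply: nZ; rewrite mem_head.
  by move=> u w; apply: rs; rewrite mem_head.
rewrite addSn; apply/(has_depth_add_elt noetherian_S (graded_max_ideal K (n + n)) _
  (var_edge_ideal_ideal K Z r) (graded_max_var K z) rz).
rewrite var_edge_ideal_add_var; apply: IHs => // [y ys|y u w ys|].
- rewrite negb_or nZ ?inE ?ys ?orbT //=.
  by apply: contraNneq zs => <-.
- by apply: rs; rewrite inE ys orbT.
move: hd; congr has_depth; apply: eq_var_edge_ideal => // i.
by rewrite inE orbA.
Qed.

(** * Cutting a union of complete graphs by the variable of one vertex *)

Section RemoveVertex.
Variables (W : {set 'I_n}) (c : 'I_n -> 'I_n) (v : 'I_n).
Hypothesis vW : v \in W.

Definition color_class : {set 'I_n} := [set u in W | c u == c v].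
Local Notation C := color_class.

(* All [x_u] of the class of [v] are killed, and their [y_u] have become free. *)
Definition half_clique_ideal : S -> Prop := var_edge_ideal
  (fun i => (vertex i \notin W) || (if split i is inl u then u \in C else false))
  (fun u w => [&& u \in W :\: C, w \in W :\: C & c u == c w]).
Local Notation half := half_clique_ideal.

Let half_ideal : ideal half. Proof. exact: var_edge_ideal_ideal. Qed.
Hint Resolve half_ideal clique_ideal_ideal : core.

Let halfX u : u \in C -> half (xvar K u).
Proof.
move=> uC; apply: var_edge_ideal_var.
by rewrite split_lshift uC orbT.
Qed.

Let half_regular : regular half (yvar K v).
Proof.
apply: var_edge_ideal_regular.
  rewrite negb_or vertex_rshift vW /=.
  by rewrite split_rshift.
move=> u w /and3P[]; rewrite vertex_rshift !inE => /andP[nu _] /andP[nw _] _.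
by split; [apply: contraNneq nu | apply: contraNneq nw] => <-; rewrite vW eqxx.
Qed.

Let half_min (I : S -> Prop) : ideal I -> (forall i, vertex i \notin W -> I 'X_i) ->
  (forall u, u \in C -> I (xvar K u)) ->
  (forall u w, u \in W :\: C -> w \in W :\: C -> c u == c w -> I (edge_binomial K u w)) ->
  forall f, half f -> I f.
Proof.
move=> hI IW IC Ib; apply: var_edge_ideal_min => // [i /orP[/IW//|]|u w /and3P[*]]; last exact: Ib.
by case: (splitP i) => // u iu uC; have -> : i = lshift n u by [exact: val_inj]; apply: IC.
Qed.

Let half_edge u w : u \in W -> w \in W -> c u == c w -> half (edge_binomial K u w).
Proof.
move=> uW wW cuw; have [uv|uv] := boolP (c u == c v).
  by apply: edge_binomial_var => //; apply: halfX; rewrite inE ?uW ?wW // -(eqP cuw).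
apply: var_edge_ideal_edge.
by rewrite !inE uW wW cuw -(eqP cuw) (negbTE uv) !andbF.
Qed.

(** Call the left side P. The clique ideal of W minus v lies in P + (y_v), so f in the intersection
    is a y_v modulo P. Since P is inside the half-clique ideal and y_v is regular modulo the latter,
    a belongs to it; and y_v times the half-clique ideal falls back into P. *)
Lemma clique_add_x :
  add_elt (clique_ideal (K := K) W c) (xvar K v) = ideal_cap half (clique_ideal (W :\ v) c).
Proof.
have hP : ideal (add_elt (clique_ideal (K := K) W c) (xvar K v)).
  exact/add_elt_ideal/clique_ideal_ideal.
have Pvar i : vertex i \notin W -> add_elt (clique_ideal (K := K) W c) (xvar K v) 'X_i.
  move=> iW; apply: add_elt_sub; first exact: clique_ideal_ideal.
  exact: var_edge_ideal_var.
have Pedge u w : u \in W -> w \in W -> c u == c w ->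
    add_elt (clique_ideal (K := K) W c) (xvar K v) (edge_binomial K u w).
  move=> uW wW cuw; apply: add_elt_sub; first exact: clique_ideal_ideal.
  by apply: var_edge_ideal_edge; rewrite uW wW.
have Pv : add_elt (clique_ideal (K := K) W c) (xvar K v) (xvar K v).
  exact/add_elt_in/clique_ideal_ideal.
apply: pred_ext => f; split.
  apply: add_elt_min.
  - by apply: ideal_cap_ideal; [exact: var_edge_ideal_ideal|exact: clique_ideal_ideal].
    apply: var_edge_ideal_min => [|i iW|u w /and3P[uW wW cuw]].
    - by apply: ideal_cap_ideal; [exact: var_edge_ideal_ideal|exact: clique_ideal_ideal].
    - split; apply: var_edge_ideal_var; first by rewrite iW.
      by rewrite !inE negb_and iW orbT.
    split; first exact: half_edge.
    have [uv|uv] := eqVneq u v.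
      apply: edge_binomial_vertex; first exact: clique_ideal_ideal.
        by apply: var_edge_ideal_var; rewrite vertex_lshift uv !inE eqxx.
      by apply: var_edge_ideal_var; rewrite vertex_rshift uv !inE eqxx.
    have [wv|wv] := eqVneq w v.
      rewrite edge_binomialN; apply: idealN; first exact: clique_ideal_ideal.
      apply: edge_binomial_vertex; first exact: clique_ideal_ideal.
        by apply: var_edge_ideal_var; rewrite vertex_lshift wv !inE eqxx.
      by apply: var_edge_ideal_var; rewrite vertex_rshift wv !inE eqxx.
    by apply: var_edge_ideal_edge; rewrite !inE uv wv uW wW.
  split; first by apply: halfX; rewrite inE vW eqxx.
  by apply: var_edge_ideal_var; rewrite vertex_lshift !inE eqxx.
case=> hf cf.
have [a fa] : add_elt (add_elt (clique_ideal (K := K) W c) (xvar K v)) (yvar K v) f.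
  move: f cf {hf}; apply: var_edge_ideal_min; first exact: add_elt_ideal.
    move=> i; rewrite !inE negb_and negbK => /orP[/eqP iv|iW].
      move: iv; case: (ord_splitP i) => u; rewrite vertexE => ->; last exact: add_elt_in.
      exact: add_elt_sub.
    by apply: add_elt_sub => //; apply: Pvar.
  move=> u w; rewrite !inE => /and3P[/andP[_ uW] /andP[_ wW] cuw].
  by apply: add_elt_sub => //; apply: Pedge.
have Phalf g : add_elt (clique_ideal (K := K) W c) (xvar K v) g -> half g.
  apply: add_elt_min => //.
    apply: var_edge_ideal_min => // [i iW|u w /and3P[uW wW cuw]].
      by apply: var_edge_ideal_var; rewrite iW.
    exact: half_edge.
  by apply: halfX; rewrite inE vW eqxx.
have ha : half a.
  apply: half_regular; have -> : yvar K v * a = f - (f - a * yvar K v) by ring.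
  by apply: idealB; [exact: var_edge_ideal_ideal|exact: hf|apply: Phalf].
rewrite -[f](subrK (a * yvar K v)); apply: idealD => //.
have hQ : ideal (fun g => add_elt (clique_ideal (K := K) W c) (xvar K v) (g * yvar K v)).
  split; first by rewrite mul0r; apply: ideal0.
    by move=> g h Pg Ph; rewrite mulrDl; apply: idealD.
  by move=> g h Ph; rewrite -mulrA; apply: idealM.
move: a ha {fa}; apply: (half_min hQ) => [i iW|u|u w uC wC cuw].
- by apply: idealMr => //; apply: Pvar.
(* Here x_u y_v is the binomial of the edge uv plus y_u x_v. *)
- rewrite inE => /andP[uW cuv].
  apply: (ideal_comb2 (a := 1) (b := yvar K u) hP (Pedge u v uW vW cuv) Pv).
  by rewrite /edge_binomial; ring.
apply: idealMr => //; move: uC wC; rewrite !inE => /andP[_ uW] /andP[_ wW].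
exact: Pedge.
Qed.

(** As y_v is regular modulo the half-clique ideal, the sum has depth exactly one less, which is
    what [has_depth_cap] asks for. *)
Lemma half_add_clique :
  ideal_add half (clique_ideal (W :\ v) c) = add_elt half (yvar K v).
Proof.
have hY : ideal (add_elt half (yvar K v)) by exact/add_elt_ideal/var_edge_ideal_ideal.
apply: pred_ext => f; split.
  apply: ideal_add_min => //; first by move=> g; apply/add_elt_sub/var_edge_ideal_ideal.
  apply: var_edge_ideal_min => //.
    move=> i; rewrite !inE negb_and negbK => /orP[/eqP iv|iW].
      move: iv; case: (ord_splitP i) => u; rewrite vertexE => ->.
        apply: add_elt_sub; first exact: var_edge_ideal_ideal.
        by apply: halfX; rewrite inE vW eqxx.
      exact/add_elt_in/var_edge_ideal_ideal.
    apply: add_elt_sub; first exact: var_edge_ideal_ideal.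
    by apply: var_edge_ideal_var; rewrite iW.
  move=> u w; rewrite !inE => /and3P[/andP[_ uW] /andP[_ wW] cuw].
  by apply: add_elt_sub; [exact: var_edge_ideal_ideal|exact: half_edge].
apply: add_elt_min.
- by apply: ideal_add_ideal; [exact: var_edge_ideal_ideal|exact: clique_ideal_ideal].
- by move=> g; apply/ideal_addl/clique_ideal_ideal.
apply: ideal_addr; first exact: var_edge_ideal_ideal.
by apply: var_edge_ideal_var; rewrite vertex_rshift !inE eqxx.
Qed.

Lemma has_depth_half d : has_depth m (clique_ideal (W :\: C) c) d ->
  has_depth m half (#|C| + d).
Proof.
move=> hd; pose s := [seq rshift n u | u <- enum C].
have -> : #|C| = size s by rewrite size_map -cardE.
have sP z : z \in s -> exists2 u, u \in C & z = rshift n u.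
  by move=> /mapP[u]; rewrite mem_enum; exists u.
apply: has_depth_free_vars.
- by rewrite map_inj_uniq ?enum_uniq //; apply: rshift_inj.
- move=> z /sP[u]; rewrite inE => /andP[uW _] ->.
  by rewrite vertex_rshift uW split_rshift.
- move=> z u w /sP[t tC ->]; rewrite vertex_rshift => /and3P[uC wC _].
  by split; apply: contraTneq tC => ->; [move: uC|move: wC]; rewrite in_setD => /andP[].
move: hd; congr has_depth; apply: eq_var_edge_ideal => // i.
case: (ord_splitP i) => u; rewrite vertexE in_setD negb_and negbK [LHS]orbC -orbA; congr (_ || _).
  rewrite split_lshift.
  suff /negbTE-> : lshift n u \notin s by rewrite orbF.
  by apply/negP => /sP[w _ /eqP]; rewrite eq_lrshift.
rewrite split_rshift orFb.
by rewrite mem_map ?mem_enum //; apply: rshift_inj.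
Qed.

(** The disjunction separates two cases. If v is alone in its class, the second ideal of
    [clique_add_x] contains the first and the intersection is the half-clique ideal; otherwise the
    two ideals have equal depth and [has_depth_cap] applies. *)
Lemma has_depth_remove_vertex d d' :
  has_depth m (clique_ideal (W :\: C) c) d -> has_depth m (clique_ideal (W :\ v) c) d' ->
  C = [set v] \/ (#|C| + d = d')%N ->
  has_depth m (clique_ideal W c) (#|C| + d).+1.
Proof.
move=> hd hd' Cd; have hh := has_depth_half hd; have hm := graded_max_ideal K (n + n).
apply/(has_depth_add_elt noetherian_S hm _ (clique_ideal_ideal K W c) (xvar_graded_max v)
  (clique_ideal_regular vW)).
rewrite clique_add_x; case: Cd => [Cv|dd'].
  suff -> : ideal_cap half (clique_ideal (W :\ v) c) = half by [].
  apply: pred_ext => f; split=> [[]//|hf]; split=> //.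
  have hc := clique_ideal_ideal K (W :\ v) c.
  move: f hf; apply: (half_min hc) => [i iW|u|u w uC wC cuw].
  - by apply: var_edge_ideal_var; rewrite in_setD1 negb_and iW orbT.
  - by rewrite Cv => /set1P->; apply: var_edge_ideal_var; rewrite vertex_lshift !inE eqxx.
  by apply: var_edge_ideal_edge; rewrite -Cv uC wC.
have C0 : (0 < #|C|)%N by apply/card_gt0P; exists v; rewrite inE vW eqxx.
case e: (#|C| + d)%N => [|D]; first by lia.
rewrite -dd' e in hd'; rewrite e in hh.
apply: (has_depth_cap noetherian_S hm half_ideal (clique_ideal_ideal K _ _) hh hd').
rewrite half_add_clique.
exact/(has_depth_add_elt noetherian_S hm _ half_ideal (yvar_graded_max v) half_regular).
Qed.

End RemoveVertex.

(** Passing to the half-clique ideal loses one colour but keeps |C| free variables; removing v loses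
    one vertex, and no colour if its class has other members. Either way the depth is one below the
    claim. *)
Theorem has_depth_clique W c : has_depth m (clique_ideal W c) (#|W| + #|c @: W|).
Proof.
have [k] := ubnP #|W|; elim: k W => [//|k IHk] W Wk.
have [->|[v vW]] := set_0Vmem W.
  rewrite cards0 imset0 cards0.
  have -> : clique_ideal set0 c = m.
    apply: pred_ext => f; split; first exact: var_edge_ideal_sub_max.
    apply: graded_max_min => [|i]; first exact: clique_ideal_ideal.
    by apply: var_edge_ideal_var; rewrite in_set0.
  by apply: has_depth_self; apply: graded_max_proper.
set C := color_class W c v.
have vC : v \in C by rewrite inE vW eqxx.
have CW : C \subset W by apply/subsetP => u; rewrite inE => /andP[].
have cardC : (#|C| + #|W :\: C|)%N = #|W| by rewrite -(cardsID C W) (setIidPr CW).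
have C0 : (0 < #|C|)%N by apply/card_gt0P; exists v.
have imC : c @: (W :\: C) = (c @: W) :\ c v.
  apply/setP => a; apply/imsetP/setD1P => [[u + ->]|[av /imsetP[u uW au]]].
    by rewrite !inE => /andP[+ uW]; rewrite uW /= => cuv; split=> //; apply: imset_f.
  by exists u; rewrite // !inE uW -au (negbTE av).
have cardim : (#|c @: W| = (#|c @: (W :\: C)|).+1)%N.
  by rewrite imC (cardsD1 (c v)) imset_f.
have cardW : #|W| = (#|W :\ v|).+1 by rewrite (cardsD1 v) vW.
have -> : (#|W| + #|c @: W| = (#|C| + (#|W :\: C| + #|c @: (W :\: C)|)).+1)%N by lia.
have [kC kv] : (#|W :\: C| < k)%N /\ (#|W :\ v| < k)%N by lia.
apply: (has_depth_remove_vertex vW (IHk _ kC) (IHk _ kv)).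
have [no|[u]] := set_0Vmem (C :\ v).
  left; apply/eqP; rewrite eqEsubset sub1set vC andbT; apply/subsetP => u uC.
  by rewrite inE; apply/negPn/negP => uv; have := in_set0 u; rewrite -no in_setD1 uv uC.
rewrite !inE => /and3P[uv uW cuv]; right.
suff -> : c @: (W :\ v) = c @: W by rewrite -/C; lia.
apply/eqP; rewrite eqEsubset imsetS ?subD1set //=; apply/subsetP => _ /imsetP[w wW ->].
have [->|wv] := eqVneq w v; last by apply: imset_f; rewrite !inE wv.
by rewrite -(eqP cuv); apply: imset_f; rewrite !inE uv.
Qed.

End CliqueDepth.

(** * Decomposition of the ideal of a join *)

Lemma mpoly_subring_ind (K : fieldType) (N : nat) (P : {mpoly K[N]} -> Prop) :
  (forall c, P c%:MP) -> (forall i, P 'X_i) ->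
  (forall f g, P f -> P g -> P (f + g)) -> (forall f g, P f -> P g -> P (f * g)) ->
  forall f, P f.
Proof.
move=> PC PX PD PM f; rewrite [f]mpolyE.
have P0 : P 0 by rewrite -(mpolyC0 N K); apply: PC.
have P1 : P 1 by apply: PC.
apply: (big_ind P P0 PD) => m _; rewrite -mul_mpolyC; apply: (PM) => //.
rewrite mpolyXE_id; apply: (big_ind P P1 PM) => i _.
by elim: (m i) => [|k IHk]; rewrite ?expr0 // exprS; apply: PM.
Qed.

Section JoinDecomposition.
Variables (K : fieldType) (n : nat).
Local Notation S := {mpoly K[n + n]}.
Implicit Types (u v w : 'I_n) (i : 'I_(n + n)) (A B W : {set 'I_n}) (e : rel 'I_n) (f g : S).

Lemma induced_ideal_ideal W e : ideal (@induced_ideal K n W e).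
Proof. exact: var_edge_ideal_ideal. Qed.
Hint Resolve induced_ideal_ideal : core.

Definition full : rel 'I_n := fun _ _ => true.

Lemma induced_ideal_edge W e u w : u \in W -> w \in W -> e u w ->
  @induced_ideal K n W e (edge_binomial K u w).
Proof. by move=> uW wW euw; apply: var_edge_ideal_edge; rewrite uW wW. Qed.

Definition restrict A : {rmorphism S -> S} :=
  sval (mpoly_rmorph_exists (@mpolyC (n + n) K) (fun i => if vertex i \in A then 'X_i else 0)).

Lemma restrictC A a : restrict A a%:MP = a%:MP.
Proof. exact: (svalP (mpoly_rmorph_exists _ _)).1. Qed.

Lemma restrictX A i : restrict A 'X_i = if vertex i \in A then 'X_i else 0.
Proof. exact: (svalP (mpoly_rmorph_exists _ _)).2. Qed.

Lemma restrict_edge A u w : restrict A (edge_binomial K u w) =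
  if (u \in A) && (w \in A) then edge_binomial K u w else 0.
Proof.
rewrite /edge_binomial /xvar /yvar rmorphB !rmorphM /= !restrictX !vertexE.
by case: (u \in A); case: (w \in A); rewrite ?mul0r ?mulr0 ?subrr.
Qed.

Variables (A : {set 'I_n}) (e : rel 'I_n).
Hypothesis e_join : forall u w, (u \in A) != (w \in A) -> e u w.

Local Notation J := (@induced_ideal K n setT e).

Let Jedge u w : (u \in A) != (w \in A) -> J (edge_binomial K u w).
Proof. by move=> uw; apply: induced_ideal_edge; rewrite ?inE //; apply: e_join. Qed.

(** In the triangle u, v, w with v on the other side, x_v b_uw = x_u b_vw - x_w b_vu for the edge
    binomials b, and likewise with y; the edges vw and vu belong to the join. *)
Lemma join_var_edge i u w : u \in A = (w \in A) -> vertex i \in A != (u \in A) ->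
  J ('X_i * edge_binomial K u w).
Proof.
move=> uw; case: (ord_splitP i) => v; rewrite vertexE => vu.
  apply: (ideal_comb2 (a := xvar K u) (b := - xvar K w) _ (Jedge (u := v) (w := w) _)
    (Jedge (u := v) (w := u) _)) => //; rewrite -?uw //.
  by rewrite /edge_binomial /xvar /yvar; ring.
apply: (ideal_comb2 (a := yvar K u) (b := - yvar K w) _ (Jedge (u := v) (w := w) _)
  (Jedge (u := v) (w := u) _)) => //; rewrite -?uw //.
by rewrite /edge_binomial /xvar /yvar; ring.
Qed.

Lemma join_restrict_edge B g u w : u \in A = (w \in A) ->
  (forall v, v \notin B -> v \in A != (u \in A)) ->
  J ((g - restrict B g) * edge_binomial K u w).
Proof.
move=> uw uB; move: g; apply: mpoly_subring_ind => [a|i|f g Jf Jg|f g Jf Jg].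
- by rewrite restrictC subrr mul0r; apply: ideal0.
- rewrite restrictX; case: ifPn => [_|iB]; first by rewrite subrr mul0r; apply: ideal0.
  by rewrite subr0; apply: join_var_edge => //; apply: uB.
- rewrite rmorphD /=; apply: (ideal_comb2 (a := 1) (b := 1) _ Jf Jg) => //; ring.
rewrite rmorphM /=.
by apply: (ideal_comb2 (a := g) (b := restrict B f) _ Jf Jg) => //; ring.
Qed.

(** Binomials of crossing edges lie in J and both restrictions kill them. For a multiple g b of a
    binomial b inside one side, [join_var_edge] lets every variable of the other side in g be set to
    0, which is one restriction of g b, while the other restriction kills b. *)
Lemma join_restrict f : @induced_ideal K n setT full f ->
  J (f - restrict A f - restrict (~: A) f).
Proof.
(* Restriction is not linear over S, so the property of f alone is not visibly closed under
   multiplication; requiring it of all multiples of f gives an ideal. *)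
pose H f := forall g, J (g * f - restrict A (g * f) - restrict (~: A) (g * f)).
have hH : ideal H.
  split=> [g|h h' Hh Hh' g|h h' Hh' g].
  - by rewrite mulr0 !rmorph0 !subr0; apply: ideal0.
  - rewrite mulrDr !rmorphD /=.
    by apply: (ideal_comb2 (a := 1) (b := 1) _ (Hh g) (Hh' g)) => //; ring.
  - by rewrite mulrA; apply: Hh'.
suff sub : forall h, @induced_ideal K n setT full h -> H h by move=> /sub/(_ 1); rewrite mul1r.
apply: (var_edge_ideal_min hH) => [i|u w _ g]; first by rewrite inE.
rewrite !rmorphM /= !restrict_edge !inE.
have [uA|uA] := boolP (u \in A); have [wA|wA] := boolP (w \in A) => /=;
  rewrite ?mulr0 ?subr0.
- rewrite -mulrBl; apply: join_restrict_edge; first by rewrite uA.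
  by move=> v /negbTE->; rewrite uA.
- by apply: idealM => //; apply: Jedge; rewrite uA (negbTE wA).
- by apply: idealM => //; apply: Jedge; rewrite (negbTE uA) wA.
rewrite -mulrBl; apply: join_restrict_edge; first by rewrite (negbTE uA) (negbTE wA).
by move=> v; rewrite inE negbK => ->; rewrite (negbTE uA).
Qed.

Lemma induced_restrict B f : @induced_ideal K n B e f -> J (restrict B f).
Proof.
have hH : ideal (fun f => J (restrict B f)).
  split=> [|h h' Hh Hh'|h h' Hh']; first by rewrite rmorph0; apply: ideal0.
    by rewrite rmorphD; apply: idealD.
  by rewrite rmorphM; apply: idealM.
move: f; apply: (var_edge_ideal_min hH) => [i iB|u w /and3P[uB wB euw]].
  by rewrite restrictX (negbTE iB); apply: ideal0.
by rewrite restrict_edge uB wB; apply: induced_ideal_edge; rewrite ?inE.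
Qed.

Lemma induced_sub W (I : S -> Prop) e' : ideal I ->
  (forall u w, u \in W -> w \in W -> e' u w -> I (edge_binomial K u w)) ->
  (forall u, u \notin W -> I (xvar K u)) -> (forall u, u \notin W -> I (yvar K u)) ->
  forall f, @induced_ideal K n W e' f -> I f.
Proof.
move=> hI IE Ix Iy; apply: var_edge_ideal_min => // [i|u w /and3P[*]]; last exact: IE.
by case: (ord_splitP i) => u; rewrite vertexE; [exact: Ix | exact: Iy].
Qed.

Lemma induced_xvar W e' u : u \notin W -> @induced_ideal K n W e' (xvar K u).
Proof. by move=> uW; apply: var_edge_ideal_var; rewrite vertexE. Qed.

Lemma induced_yvar W e' u : u \notin W -> @induced_ideal K n W e' (yvar K u).
Proof. by move=> uW; apply: var_edge_ideal_var; rewrite vertexE. Qed.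

Lemma induced_mono W (e' e'' : rel 'I_n) :
  (forall u w, u \in W -> w \in W -> e' u w -> e'' u w) ->
  forall f, @induced_ideal K n setT e' f -> @induced_ideal K n W e'' f.
Proof.
move=> ee; apply: induced_sub => // [u w _ _ euw|u|u]; try by rewrite inE.
have [uW|uW] := boolP (u \in W); last first.
  by apply: edge_binomial_vertex => //; [exact: induced_xvar | exact: induced_yvar].
have [wW|wW] := boolP (w \in W); first by apply: induced_ideal_edge => //; apply: ee.
rewrite edge_binomialN; apply: idealN => //.
by apply: edge_binomial_vertex => //; [exact: induced_xvar | exact: induced_yvar].
Qed.

Lemma join_decomposition :
  ideal_cap (@induced_ideal K n A e)
    (ideal_cap (@induced_ideal K n (~: A) e) (@induced_ideal K n setT full)) = J.
Proof.
apply: pred_ext => f; split=> [[fA [fB /join_restrict fK]]|Jf]; last first.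
  by do 2?split; apply: induced_mono Jf.
have := idealD (induced_ideal_ideal setT e) fK
  (idealD (induced_ideal_ideal setT e) (induced_restrict fA) (induced_restrict fB)).
by congr J; ring.
Qed.

(** The binomials on A come from the second summand: they lie in the ideal of [~: A], which contains
    all variables of A, and in that of the complete graph. *)
Lemma join_add : ideal_add (@induced_ideal K n A e)
    (ideal_cap (@induced_ideal K n (~: A) e) (@induced_ideal K n setT full)) =
  @induced_ideal K n A full.
Proof.
have hC : ideal (ideal_cap (@induced_ideal K n (~: A) e) (@induced_ideal K n setT full)).
  exact: ideal_cap_ideal.
apply: pred_ext => f; split.
  apply: ideal_add_min => // g; last by case=> _; apply: induced_mono.
  apply: induced_sub => // [u w uA wA _|u|u].
  - exact: induced_ideal_edge.
  - exact: induced_xvar.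
  - exact: induced_yvar.
apply: induced_sub => // [|u w uA wA _|u uA|u uA]; first exact: ideal_add_ideal.
- apply: ideal_addr => //; split; last by apply: induced_ideal_edge; rewrite ?inE.
  by apply: edge_binomial_vertex => //; [apply: induced_xvar|apply: induced_yvar]; rewrite inE uA.
- by apply: ideal_addl => //; apply: induced_xvar.
- by apply: ideal_addl => //; apply: induced_yvar.
Qed.

Lemma induced_add_full B : ideal_add (@induced_ideal K n B e) (@induced_ideal K n setT full) =
  @induced_ideal K n B full.
Proof.
apply: pred_ext => f; split.
  apply: ideal_add_min => // g; last exact: induced_mono.
  apply: induced_sub => // [u w uA wA _|u|u].
  - exact: induced_ideal_edge.
  - exact: induced_xvar.
  - exact: induced_yvar.
apply: induced_sub => // [|u w uA wA _|u uA|u uA]; first exact: ideal_add_ideal.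
- by apply: ideal_addr => //; apply: induced_ideal_edge; rewrite ?inE.
- by apply: ideal_addl => //; apply: induced_xvar.
- by apply: ideal_addl => //; apply: induced_yvar.
Qed.

End JoinDecomposition.

(** * Depth of a join *)

Section JoinDepth.
Variables (K : fieldType) (n : nat).
Local Notation S := {mpoly K[n + n]}.
Local Notation m := (@graded_max K (n + n)).
Implicit Types (A B W : {set 'I_n}) (e : rel 'I_n) (c : 'I_n -> 'I_n).

Hint Resolve induced_ideal_ideal graded_max_ideal : core.

Lemma has_depth_full A : (0 < #|A|)%N -> has_depth m (induced_ideal A (@full n)) (#|A| + 1).
Proof.
case/card_gt0P=> u uA; have := @has_depth_clique K n A (fun _ => u).
have -> : [set u | _ in A] = [set u].
  apply/setP => w; rewrite inE; apply/imsetP/eqP => [[_ _ ->]//|->].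
  by exists u.
rewrite cards1; congr has_depth; apply: eq_var_edge_ideal => // v w.
by rewrite eqxx.
Qed.

(** The ideal [clique_ideal A c] lies between the ideal of e on A and that of the complete graph on
    A. Two colours give it depth at least |A| + 2, one more than the depth |A| + 1 of the sum in
    [join_add]; this fixes the range of t. *)
Lemma depth_ge_join_side t A e c :
  (forall u w, (u \in A) != (w \in A) -> e u w) ->
  (forall u w, u \in A -> w \in A -> e u w -> c u = c w) -> (1 < #|c @: A|)%N ->
  depth_ge m t (induced_ideal setT e) -> (t <= #|A| + 2)%N ->
  depth_ge m t (induced_ideal A e).
Proof.
move=> e_join ce c1; case: t => // t dJ tA.
have A0 : (0 < #|A|)%N by apply: leq_trans (ltnW c1) (leq_imset_card c A).
have hC : ideal (ideal_cap (@induced_ideal K n (~: A) e) (induced_ideal setT (@full n))).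
  exact: ideal_cap_ideal.
apply: (depth_ge_through (@mpoly_noetherian K (n + n)) (graded_max_ideal K (n + n))
  (induced_ideal_ideal K A e) hC (clique_ideal_ideal K A c)).
- apply: induced_sub; first exact: clique_ideal_ideal.
  + move=> u w uA wA euw; apply: var_edge_ideal_edge; rewrite uA wA.
    by apply/eqP/ce.
  + by move=> u; apply: induced_xvar.
  + by move=> u; apply: induced_yvar.
- rewrite join_add; apply: induced_sub; first exact: induced_ideal_ideal.
  + by move=> u w uA wA _; apply: induced_ideal_edge.
  + by move=> u; apply: induced_xvar.
  + by move=> u; apply: induced_yvar.
- by apply/has_depth_clique; lia.
- by rewrite join_add; apply/has_depth_full => //; lia.
- by rewrite join_decomposition.
Qed.

Lemma depth_ge_join t A e c c' :
  (forall u w, (u \in A) != (w \in A) -> e u w) ->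
  (forall u w, u \in A -> w \in A -> e u w -> c u = c w) -> (1 < #|c @: A|)%N ->
  (forall u w, u \in ~: A -> w \in ~: A -> e u w -> c' u = c' w) -> (1 < #|c' @: ~: A|)%N ->
  (#|A| <= #|~: A|)%N ->
  depth_ge m t (induced_ideal setT e) <->
    [/\ depth_ge m t (induced_ideal A e), depth_ge m t (induced_ideal (~: A) e)
      & (t <= #|A| + 2)%N].
Proof.
move=> e_join ce c1 ce' c1' AB.
have hn := @mpoly_noetherian K (n + n); have hm := graded_max_ideal K (n + n).
have [[hA hB] hK] := (induced_ideal_ideal K A e, induced_ideal_ideal K (~: A) e,
  induced_ideal_ideal K setT (@full n)).
have A2 : (2 <= #|A|)%N by apply: leq_trans (leq_imset_card c A).
have B2 : (2 <= #|~: A|)%N by lia.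
have cardT : #|[set: 'I_n]| = (#|A| + #|~: A|)%N by rewrite cardsC cardsT.
have dKA : has_depth m (induced_ideal A (@full n)) (#|A| + 1) by apply: has_depth_full; lia.
have dKB : has_depth m (induced_ideal (~: A) (@full n)) (#|~: A| + 1).
  by apply: has_depth_full; lia.
have dKT : has_depth m (induced_ideal setT (@full n)) (#|A| + #|~: A| + 1).
  by rewrite -cardT; apply: has_depth_full; lia.
(* The sum of the two ideals has depth |~: A| + 1, which is at least s - 1 because |A| <= |~: A|. *)
have capB s : (s <= #|A| + 2)%N -> depth_ge m s (induced_ideal (~: A) e) ->
    depth_ge m s (ideal_cap (induced_ideal (~: A) e) (induced_ideal setT (@full n))).
  move=> sA sB; apply: depth_ge_cap => //; first by apply/dKT; lia.
  by rewrite induced_add_full; apply/dKB; lia.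
have sideA s : depth_ge m s (induced_ideal setT e) -> (s <= #|A| + 2)%N ->
    depth_ge m s (induced_ideal A e) by apply: depth_ge_join_side ce c1.
have sideB s : depth_ge m s (induced_ideal setT e) -> (s <= #|~: A| + 2)%N ->
    depth_ge m s (induced_ideal (~: A) e).
  apply: depth_ge_join_side ce' c1' => u w; rewrite !inE => uw.
  by apply: e_join; move: uw; case: (u \in A); case: (w \in A).
have hC : ideal (ideal_cap (@induced_ideal K n (~: A) e) (induced_ideal setT (@full n))).
  exact: ideal_cap_ideal.
split=> [dJ|[dA dB tA]].
  suff tA : (t <= #|A| + 2)%N by split=> //; [apply: sideA|apply: sideB => //; lia].
  rewrite leqNgt; apply/negP => tA.
  have dJ3 : depth_ge m (#|A| + 2).+1 (induced_ideal setT e) by apply: depth_ge_leq dJ.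
  have dJ2 := depth_geS dJ3.
  suff : (#|A| + 2 <= #|A| + 1)%N by lia.
  apply/dKA; rewrite -(join_add K A e); apply: depth_ge_add => //.
  - exact: sideA.
  - by apply: capB => //; apply: sideB => //; lia.
  - by rewrite join_decomposition.
rewrite -(join_decomposition K e_join); apply: depth_ge_cap => //; first exact: capB.
by rewrite join_add; apply/dKA; lia.
Qed.

End JoinDepth.

(** * From an induced subgraph in S to the polynomial ring on its own vertices *)

Section Restriction.
Variables (K : fieldType) (k n : nat) (j : 'I_k -> 'I_n) (e : rel 'I_n).
Hypothesis j_inj : injective j.

(** The default 0 matches the induced ideal, which contains the variables of all vertices outside
    the image of j. *)
Let pull (v : 'I_k -> {mpoly K[k + k]}) (u : 'I_n) : {mpoly K[k + k]} :=
  if [pick a | j a == u] is Some a then v a else 0.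

Let pull_image v a : pull v (j a) = v a.
Proof. by rewrite /pull; case: pickP => [b /eqP/j_inj->//|/(_ a)]; rewrite eqxx. Qed.

Let pull_out v u : u \notin j @: setT -> pull v u = 0.
Proof. by rewrite /pull; case: pickP => // a /eqP<-; rewrite imset_f. Qed.

Let phi : {rmorphism {mpoly K[n + n]} -> {mpoly K[k + k]}} :=
  sval (mpoly_rmorph_exists (@mpolyC (k + k) K) (fun i =>
    match split i with inl u => pull (@xvar K k) u | inr u => pull (@yvar K k) u end)).

Let psi : {rmorphism {mpoly K[k + k]} -> {mpoly K[n + n]}} :=
  sval (mpoly_rmorph_exists (@mpolyC (n + n) K) (fun i =>
    match split i with inl a => xvar K (j a) | inr a => yvar K (j a) end)).

Let phiC a : phi a%:MP = a%:MP.
Proof. exact: (svalP (mpoly_rmorph_exists _ _)).1. Qed.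
Let phix u : phi (xvar K u) = pull (@xvar K k) u.
Proof. by rewrite (svalP (mpoly_rmorph_exists _ _)).2 split_lshift. Qed.
Let phiy u : phi (yvar K u) = pull (@yvar K k) u.
Proof. by rewrite (svalP (mpoly_rmorph_exists _ _)).2 split_rshift. Qed.
Let psiC a : psi a%:MP = a%:MP.
Proof. exact: (svalP (mpoly_rmorph_exists _ _)).1. Qed.
Let psix a : psi (xvar K a) = xvar K (j a).
Proof. by rewrite (svalP (mpoly_rmorph_exists _ _)).2 split_lshift. Qed.
Let psiy a : psi (yvar K a) = yvar K (j a).
Proof. by rewrite (svalP (mpoly_rmorph_exists _ _)).2 split_rshift. Qed.

Let psiK : cancel psi phi.
Proof.
apply: mpoly_subring_ind => [a|i|f g f_ g_|f g f_ g_].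
- by rewrite psiC phiC.
- case: (ord_splitP i) => a; first by rewrite psix phix pull_image.
  by rewrite psiy phiy pull_image.
- by rewrite !rmorphD /= f_ g_.
- by rewrite !rmorphM /= f_ g_.
Qed.

Let e_j : rel 'I_k := fun a b => e (j a) (j b).
Let B := j @: [set: 'I_k].

Let hB : ideal (@induced_ideal K n B e). Proof. exact: induced_ideal_ideal. Qed.
Let hE : ideal (@binomial_edge_ideal K k e_j). Proof. exact: ideal_gen_ideal. Qed.

Let induced_psi_phi f : induced_ideal B e (f - psi (phi f)).
Proof.
move: f; apply: mpoly_subring_ind => [a|i|f g f_ g_|f g f_ g_].
- by rewrite phiC psiC subrr; apply: ideal0.
- case: (ord_splitP i) => u; have [/imsetP[a _ ->]|uB] := boolP (u \in B).
  + by rewrite phix pull_image psix subrr; apply: ideal0.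
  + by rewrite phix pull_out // rmorph0 subr0; apply: induced_xvar.
  + by rewrite phiy pull_image psiy subrr; apply: ideal0.
  + by rewrite phiy pull_out // rmorph0 subr0; apply: induced_yvar.
- by rewrite !rmorphD /=; apply: (ideal_comb2 (a := 1) (b := 1) hB f_ g_); ring.
- rewrite !rmorphM /=.
  by apply: (ideal_comb2 (a := g) (b := psi (phi f)) hB f_ g_); ring.
Qed.

Let induced_preim : @induced_ideal K n B e = fun f => binomial_edge_ideal e_j (phi f).
Proof.
apply: pred_ext => f; split.
  have hP : ideal (fun f => binomial_edge_ideal e_j (phi f)).
    split=> [|g h g_ h_|g h h_]; first by rewrite rmorph0; apply: ideal0.
      by rewrite rmorphD; apply: idealD.
    by rewrite rmorphM; apply: idealM.
  move: f; apply: (induced_sub hP) => [u w /imsetP[a _ ->] /imsetP[b _ ->] eab|u uB|u uB].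
  - apply: ideal_gen_in; exists a, b; split=> //.
    by rewrite rmorphB !rmorphM /= !phix !phiy !pull_image.
  - by rewrite phix pull_out //; apply: ideal0.
  - by rewrite phiy pull_out //; apply: ideal0.
move=> Ef; rewrite -[f](subrK (psi (phi f))); apply: idealD => //.
have hP : ideal (fun g => @induced_ideal K n B e (psi g)).
  split=> [|g h g_ h_|g h h_]; first by rewrite rmorph0; apply: ideal0.
    by rewrite rmorphD; apply: idealD.
  by rewrite rmorphM; apply: idealM.
apply: (ideal_gen_min hP _ Ef) => _ [a [b [eab ->]]].
rewrite rmorphB !rmorphM /= !psix !psiy.
by apply: induced_ideal_edge => //; apply: imset_f.
Qed.

Lemma depth_ge_induced t :
  depth_ge (@graded_max K (n + n)) t (induced_ideal (j @: setT) e) <->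
  depth_ge (@graded_max K (k + k)) t (binomial_edge_ideal (fun a b => e (j a) (j b))).
Proof.
have hn := graded_max_ideal K (n + n); have hk := graded_max_ideal K (k + k).
rewrite -/B induced_preim; apply: (depth_ge_preim (psi := psi)) => //.
  have hP : ideal (fun f => graded_max (phi f)).
    split=> [|g h g_ h_|g h h_]; first by rewrite rmorph0; apply: ideal0.
      by rewrite rmorphD; apply: idealD.
    by rewrite rmorphM; apply: idealM.
  apply: (graded_max_min hP) => i; case: (ord_splitP i) => u.
    by rewrite phix /pull; case: pickP => *; [apply: graded_max_var|apply: ideal0].
  by rewrite phiy /pull; case: pickP => *; [apply: graded_max_var|apply: ideal0].
have hP : ideal (fun f => graded_max (psi f)).
  split=> [|g h g_ h_|g h h_]; first by rewrite rmorph0; apply: ideal0.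
    by rewrite rmorphD; apply: idealD.
  by rewrite rmorphM; apply: idealM.
apply: (graded_max_min hP) => i; case: (ord_splitP i) => a.
  by rewrite psix; apply: graded_max_var.
by rewrite psiy; apply: graded_max_var.
Qed.

End Restriction.

(** * Binomial edge ideals and colourings of disconnected graphs *)

Lemma binomial_edge_idealE (K : fieldType) (n : nat) (e : rel 'I_n) :
  @binomial_edge_ideal K n e = induced_ideal setT e.
Proof.
apply: pred_ext => f; split.
  apply: ideal_gen_min => [|_ [u [w [euw ->]]]]; first exact: induced_ideal_ideal.
  by apply: induced_ideal_edge; rewrite ?inE.
apply: induced_sub => [|u w _ _ euw|u|u]; try by rewrite inE.
  exact: ideal_gen_ideal.
by apply: ideal_gen_in; exists u, w.
Qed.

Lemma depth_bei_ge (K : fieldType) (n : nat) (e : rel 'I_n) :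
  has_depth (@graded_max K (n + n)) (binomial_edge_ideal e) (depth_bei K e).
Proof.
apply: depthP; [exact: mpoly_noetherian|exact: graded_max_ideal|exact: ideal_gen_ideal
  |exact: graded_max_proper|].
by move=> f; rewrite binomial_edge_idealE; apply: var_edge_ideal_sub_max.
Qed.

(** One colour goes to the component of u and another to everything else. The vertices [j u] and
    [j v] serve as colours because [clique_ideal] takes a map from ['I_n] to itself. *)
Lemma disconnected_coloring (k n : nat) (j : 'I_k -> 'I_n) (e : rel 'I_k) :
  injective j -> ssrbool.symmetric e -> disconnected e ->
  exists2 c : 'I_n -> 'I_n, forall a b, e a b -> c (j a) = c (j b) &
    (1 < #|c @: (j @: setT)|)%N.
Proof.
move=> j_inj e_sym [u [v nuv]].
pose c w := if [exists a, (j a == w) && connect e u a] then j u else j v.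
have cj a : c (j a) = if connect e u a then j u else j v.
  rewrite /c; congr (if _ then _ else _).
  apply/existsP/idP => [[b /andP[/eqP/j_inj->]]//|ua].
  by exists a; rewrite eqxx.
exists c => [a b eab|].
  by rewrite !cj (same_connect_r (sym_connect_sym e_sym) (connect1 eab)).
have uv : j u != j v by rewrite (inj_eq j_inj); apply: contraNneq nuv => ->.
apply: (@leq_trans #|[set j u; j v]|); first by rewrite cards2 uv.
apply/subset_leq_card/subsetP => w; rewrite !inE => /orP[]/eqP->; apply/imsetP.
  by exists (j u); rewrite ?imset_f // cj connect0.
by exists (j v); rewrite ?imset_f // cj (negbTE nuv).
Qed.

Local Close Scope ring_scope.

Theorem theorem4p4 (K : fieldType) (n1 n2 : nat)
    (e1 : rel 'I_n1) (e2 : rel 'I_n2)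
    (G1_simple : simple_graph e1) (G2_simple : simple_graph e2)
    (G1_disc : disconnected e1) (G2_disc : disconnected e2)
    (le_n1_n2 : n1 <= n2) :
  depth_bei K (join e1 e2)
  = minn (minn (depth_bei K e1) (depth_bei K e2)) (n1 + 2).
Proof.
have [[e1_sym _] [e2_sym _]] := (G1_simple, G2_simple).
pose A : {set 'I_(n1 + n2)} := lshift n2 @: setT.
have AC : ~: A = @rshift n1 n2 @: setT.
  apply/setP => u; rewrite inE; case: (split_ordP u) => a ->.
    rewrite imset_f //=; apply/esym/negP => /imsetP[b _ /eqP].
    by rewrite eq_lrshift.
  rewrite [RHS]imset_f //; apply/negP => /imsetP[b _ /eqP].
  by rewrite eq_rlshift.
have joinl : (fun a b => join e1 e2 (lshift n2 a) (lshift n2 b)) = e1.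
  by do 2!(apply: functional_extensionality => ?); rewrite /join !split_lshift.
have joinr : (fun a b => join e1 e2 (rshift n1 a) (rshift n1 b)) = e2.
  by do 2!(apply: functional_extensionality => ?); rewrite /join !split_rshift.
have linj := @lshift_inj n1 n2; have rinj := @rshift_inj n1 n2.
have [c1 c1e c1A] := disconnected_coloring linj e1_sym G1_disc.
have [c2 c2e c2A] := disconnected_coloring rinj e2_sym G2_disc.
have cardA : #|A| = n1 by rewrite card_imset // cardsT card_ord.
have cardB : #|~: A| = n2 by rewrite AC card_imset // cardsT card_ord.
have inl a : lshift n2 a \in A by apply: imset_f.
have inr a : (rshift n1 a \in A) = false by apply/negbTE; rewrite -in_setC AC imset_f.
have e_join u w : (u \in A) != (w \in A) -> join e1 e2 u w.
  case: (split_ordP u) => a ->; case: (split_ordP w) => b ->; rewrite ?inl ?inr //.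
    by rewrite /join split_lshift split_rshift.
  by rewrite /join split_lshift split_rshift.
have c1P u w : u \in A -> w \in A -> join e1 e2 u w -> c1 u = c1 w.
  move=> /imsetP[a _ ->] /imsetP[b _ ->].
  by rewrite /join !split_lshift; apply: c1e.
have c2P u w : u \in ~: A -> w \in ~: A -> join e1 e2 u w -> c2 u = c2 w.
  rewrite AC => /imsetP[a _ ->] /imsetP[b _ ->].
  by rewrite /join !split_rshift; apply: c2e.
have dA t := depth_ge_induced K (join e1 e2) linj t.
have dB t := depth_ge_induced K (join e1 e2) rinj t.
have dG t := @depth_ge_join K _ t A (join e1 e2) c1 c2 e_join c1P c1A c2P.
rewrite -AC joinr in dB; rewrite joinl -/A in dA.
rewrite -binomial_edge_idealE cardA cardB in dG; rewrite -AC in c2A.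
(* A depth is determined by the numbers below it, so a conjunction of three bounds turns into a
   minimum. *)
have dJ t : t <= depth_bei K (join e1 e2) <->
    [/\ t <= depth_bei K e1, t <= depth_bei K e2 & t <= n1 + 2].
  rewrite -(depth_bei_ge K (join e1 e2)); split=> [/(dG t c2A le_n1_n2)[tA tB tn]|[t1 t2 tn]].
    by split=> //; [apply/(depth_bei_ge K e1)/dA | apply/(depth_bei_ge K e2)/dB].
  apply/(dG t c2A le_n1_n2); split=> //.
    by apply/dA/(depth_bei_ge K e1).
  by apply/dB/(depth_bei_ge K e2).
set d := depth_bei K (join e1 e2); set d1 := depth_bei K e1; set d2 := depth_bei K e2.
have [] := (dJ d).1 (leqnn _); have := (dJ (minn (minn d1 d2) (n1 + 2))).2.
rewrite -/d -/d1 -/d2 => le_d d_d1 d_d2 d_n1.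
apply/eqP; rewrite eqn_leq !leq_min d_d1 d_d2 d_n1 /= le_d //.
by split; lia.
Qed.
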